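(* Let $n\ge 2$ and $n/2<\alpha\le n$, and set $$s:=\frac{n}{2(n+1)}+\frac{n-1}{2(n+1)}(n-\alpha).$$ Then for every $s'<s$ there exists a function $f\in H^{s'}(\mathbb{R}^n)$ such that $$\limsup_{t\to 0^+}\big|e^{it\hbar\Delta/2}f(x)\big|=\infty$$ for all $x$ in a set of Hausdorff dimension $\ge \alpha$.
   Context: $\hbar=1/(2\pi)$, so $u(x,t)=e^{it\hbar\Delta/2}f(x)$ is the solution of $\partial_t u=i\frac{\hbar}{2}\Delta u$, $u(\cdot,0)=f$. The Fourier transform is $\hat f(\xi)=\int f(x)e^{-2\pi i x\cdot\xi}\,dx$. For $f\in H^{s'}(\mathbb{R}^n)$ the solution is defined pointwise by $e^{it\hbar\Delta/2}f(x)=\lim_{N\to\infty}\int_{Q(N)}\hat f(\xi)e^{i(-\pi t|\xi|^2+2\pi x\cdot\xi)}\,d\xi$ at every point $x$ where this limit exists, where $Q(N)$ is the cube of side-length $N$ centered at the origin. *)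

(* Defs.v *)
(* R^n is modelled as n.-tuple R, with its product
   (Borel) sigma-algebra provided by MathComp-Analysis. *)
From HB Require Import structures.
From mathcomp Require Import all_boot all_order all_algebra.
From mathcomp Require Import all_classical all_reals all_analysis.
Set Implicit Arguments. Unset Strict Implicit. Unset Printing Implicit Defensive.
Import Order.TTheory GRing.Theory Num.Theory.
Import numFieldNormedType.Exports.
Local Open Scope classical_set_scope.
Local Open Scope ring_scope.

Section Defs.
Context {R : realType} {n : nat}.
Local Notation Rn := (n.-tuple R).

Definition dotn (x y : Rn) : R := \sum_(i < n) tnth x i * tnth y i.
Definition normn2 (x : Rn) : R := \sum_(i < n) tnth x i ^+ 2.
Definition distn (x y : Rn) : R :=
  Num.sqrt (\sum_(i < n) (tnth x i - tnth y i) ^+ 2).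

Definition box (a b : 'I_n -> R) : set Rn :=
  [set x | forall i, a i <= tnth x i <= b i].

Definition lebn (A : set Rn) : \bar R :=
  ereal_inf [set r | exists (a b : nat -> 'I_n -> R),
    (forall k i, a k i <= b k i) /\ A `<=` \bigcup_k box (a k) (b k) /\
    r = (\sum_(k <oo) (\prod_(i < n) (b k i - a k i))%:E)%E].

Definition cubeQ (N : R) : set Rn :=
  [set xi | forall i, - (N / 2) <= tnth xi i <= N / 2].

(* A complex-valued function on R^n is given by its real and imaginary parts. *)
Definition phase (t : R) (x xi : Rn) : R :=
  - (pi * t * normn2 xi) + 2 * pi * dotn x xi.

(* Real and imaginary parts of  \int_{Q(N)} fhat(xi) e^{i phase} dxi,
   where fhat = gre + i gim. *)
Definition partial_re (gre gim : Rn -> R) (t : R) (x : Rn) (N : R) : R :=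
  fine (integral lebn (cubeQ N)
    (fun xi => (gre xi * cos (phase t x xi) - gim xi * sin (phase t x xi))%:E)).
Definition partial_im (gre gim : Rn -> R) (t : R) (x : Rn) (N : R) : R :=
  fine (integral lebn (cubeQ N)
    (fun xi => (gre xi * sin (phase t x xi) + gim xi * cos (phase t x xi))%:E)).

(* [schr_at gre gim t x v] : the limit defining e^{i t hbar Delta/2} f (x)
   exists and its modulus is v (f^ = gre + i gim). *)
Definition schr_at (gre gim : Rn -> R) (t : R) (x : Rn) (v : R) : Prop :=
  exists lre lim_ : R,
    (partial_re gre gim t x N @[N --> +oo] --> lre) /\
    (partial_im gre gim t x N @[N --> +oo] --> lim_) /\
    v = Num.sqrt (lre ^+ 2 + lim_ ^+ 2).

(* limsup_{t -> 0+} |e^{i t hbar Delta/2} f(x)| = +oo  (over the times t at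
   which the solution is defined) *)
Definition schr_limsup_infty (gre gim : Rn -> R) (x : Rn) : Prop :=
  forall (M delta : R), 0 < delta ->
    exists t v, 0 < t < delta /\ schr_at gre gim t x v /\ M < v.

(* f in H^s(R^n), expressed on its Fourier transform fhat = gre + i gim:
   fhat measurable and  \int (1+|xi|^2)^s |fhat(xi)|^2 dxi < oo. *)
Definition in_Hs_hat (s : R) (gre gim : Rn -> R) : Prop :=
  measurable_fun setT gre /\ measurable_fun setT gim /\
  (integral lebn setT
     (fun xi => (((1 + normn2 xi) `^ s) * (gre xi ^+ 2 + gim xi ^+ 2))%:E)
   < +oo)%E.

Definition diamn (U : set Rn) : \bar R :=
  ereal_sup [set (distn x y)%:E | x in U & y in U].

Definition hcost (beta : R) (U : set Rn) : \bar R :=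
  if `[< U = set0 >] then 0%E else ((fine (diamn U)) `^ beta)%:E.

Definition hausdorff_content (beta delta : R) (A : set Rn) : \bar R :=
  ereal_inf [set (\sum_(k <oo) hcost beta (U k))%E |
    U in [set U : nat -> set Rn |
      A `<=` \bigcup_k U k /\ forall k, (diamn (U k) <= delta%:E)%E]].

Definition hausdorff_measure (beta : R) (A : set Rn) : \bar R :=
  ereal_sup [set hausdorff_content beta delta A | delta in [set d : R | 0 < d]].

Definition hausdorff_dim (A : set Rn) : \bar R :=
  ereal_inf [set beta%:E | beta in [set b : R | 0 <= b /\ hausdorff_measure b A = 0%E]].

End Defs.

(* Main.v *)
(* At a scale T, take frequencies whose first coordinate lies in [T, T + c sqrt T], and whose
   other coordinates lie within c of the progressions D l + D/(2 J_i) with D l <= T, where D ~ T^a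
   and the moduli J_i ~ T^j are pairwise coprime.  Let x be close to a point of the lattice with
   steps 2 K T/D^2 (where K = prod J_i) and 1/(D J_i).  The Chinese remainder theorem provides an
   integer p congruent to the last coordinates of that point modulo the J_i and with x_1 close to
   t T for t = 2p/D^2; at this time t ~ 1/T the phase is, up to a small error and integer multiples
   of 2 pi, constant on all the frequencies, so the wave is as large as its mass.  No Gauss sums
   are needed: the times are adapted to x so that all the exponentials are equal.

   The datum is a sum of such blocks along a very rapidly increasing sequence of scales.  At the
   resonant time of the k-th block, of mass 8^k, the earlier blocks have total mass at most 8^k/7,
   while the later ones are negligible by nonstationary phase in the first coordinate, uniformly
   in the cutoff Q(N).  The points close to the lattices at all scales contain a product of Cantor
   sets parametrised by a cube, in which the preimage of a set of diameter r has volume O(r^beta)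
   for every beta < alpha; this bounds the Hausdorff dimension from below. *)

Require Import Defs.
From HB Require Import structures.
From mathcomp Require Import all_boot all_order all_algebra.
From mathcomp Require Import all_classical all_reals all_analysis.
From mathcomp Require Import measurable_realfun.
From mathcomp Require Import ring lra zify.
Set Implicit Arguments. Unset Strict Implicit. Unset Printing Implicit Defensive.
Import Order.TTheory GRing.Theory Num.Theory.
Import numFieldNormedType.Exports.
Local Open Scope classical_set_scope.
Local Open Scope ring_scope.

(** * Lebesgue measure on tuples *)

(** Where the exponents come from, in dimension N = d + 1. A block has volume about T^(1/2 +
    d(1-a)), and unit mass spread over it costs T^(2s) divided by that volume in squared norm, so 2s
    < 1/2 + d(1-a) is what makes the datum regular. Covering the neighbourhood of the lattice takes
    about T^(e + 1/2 + d b) balls of radius 1/T, and this exponent has to be alpha. As e = 2a - 1 -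
    jd and b = a + j, the parameter j cancels: a = (alpha + 1/2)/(N + 1) is forced, and the critical
    s follows from it. With j = 0 and 2a > 3/2, however, the steps in x_1 would be finer than the
    tolerance T^(-1/2), and part of the lattice would be wasted. The moduli spend this surplus on
    the other coordinates. The limit over Q(N) has to exist at each time used; this is why the
    estimates for late blocks must hold uniformly on blocks cut by a cube. Finally [lebn] is a bare
    infimum over covers, and it has to be recognised as a product measure before Fubini can be
    applied. *)

Section outer.
Context {R : realType}.

Definition bvol {n} (a b : 'I_n -> R) : R := \prod_(i < n) (b i - a i).

Lemma bvol_ge0 n (a b : 'I_n -> R) : (forall i, a i <= b i) -> 0 <= bvol a b.
Proof. by move=> ab; apply: prodr_ge0 => i _; rewrite subr_ge0. Qed.

(** Fails in dimension 0, where the empty product gives every box volume 1 and makes [lebn set0]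
    infinite; hence the measure is built on tuples of length [n.+1]. Degenerate boxes pad finite
    covers into sequences. *)
Lemma bvol_degenerate n (a : 'I_n.+1 -> R) : bvol a a = 0.
Proof. by rewrite /bvol big_ord_recl subrr mul0r. Qed.

Definition boxcover n (A : set (n.-tuple R)) (a b : nat -> 'I_n -> R) :=
  (forall k i, a k i <= b k i) /\ A `<=` \bigcup_k box (a k) (b k).

Lemma lebn_le_cover n (A : set (n.-tuple R)) a b : boxcover A a b ->
  (lebn A <= \sum_(k <oo) (bvol (a k) (b k))%:E)%E.
Proof.
by move=> [ab Aab]; apply: ereal_inf_lbound => /=; exists a, b.
Qed.

Lemma lebn_ge0 n (A : set (n.-tuple R)) : (0 <= lebn A)%E.
Proof.
apply: le_ereal_inf_tmp => _ [a [b [ab [_ ->]]]].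
by apply: nneseries_ge0 => k _ _; rewrite lee_fin bvol_ge0.
Qed.

Lemma lebn_cover_near n (A : set (n.-tuple R)) (e : R) : 0 < e ->
  (lebn A < +oo)%E -> exists ab : (nat -> 'I_n -> R) * (nat -> 'I_n -> R),
  boxcover A ab.1 ab.2 /\
  (\sum_(k <oo) (bvol (ab.1 k) (ab.2 k))%:E <= lebn A + e%:E)%E.
Proof.
move=> e0 Aoo.
have Afin : lebn A \is a fin_num by rewrite ge0_fin_numE ?lebn_ge0.
have [_ [a [b [ab [Aab ->]]]] /ltW] := lb_ereal_inf_adherent e0 Afin.
by move=> le_e; exists (a, b); split.
Qed.

Lemma lebn_subset_subadditive n (A : set (n.-tuple R)) (F : (set (n.-tuple R))^nat) :
  A `<=` \bigcup_k F k -> (lebn A <= \sum_(i <oo) lebn (F i))%E.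
Proof.
move=> AF; have [[i ioo]|] := pselect (exists i, lebn (F i) = +oo%E).
  rewrite (eseries_pinfty _ _ ioo) ?leey// => k _.
  by rewrite -ltNye (lt_le_trans _ (lebn_ge0 _)).
rewrite -forallNE => Foo; apply/lee_addgt0Pr => e e0.
apply: (le_trans _ (epsilon_trick _ _ (ltW e0))); last by move=> k; exact: lebn_ge0.
have /choice[G PG] : forall k, exists ab : (nat -> 'I_n -> R) * (nat -> 'I_n -> R),
    boxcover (F k) ab.1 ab.2 /\ (\sum_(j <oo) (bvol (ab.1 j) (ab.2 j))%:E <=
    lebn (F k) + (e / (2 ^ k.+1)%:R)%:E)%E.
  move=> k; apply: lebn_cover_near; first by rewrite divr_gt0// ltr0n expn_gt0.
  by rewrite ltey; apply/eqP/Foo.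
pose v (p : nat * nat) : \bar R := (bvol ((G p.1).1 p.2) ((G p.1).2 p.2))%:E.
have v0 p : (0 <= v p)%E by rewrite lee_fin bvol_ge0//; exact: (PG p.1).1.1.
have v0' i j : (0 <= v (i, j))%E by [].
have /card_esym/ppcard_eqP[f] := card_nat2.
apply: (@le_trans _ _ (\esum_(p in setT) v p)%E); last first.
  rewrite (_ : esum _ _ = \sum_(i <oo) \sum_(j <oo ) v (i, j))%E; last first.
    rewrite nneseries_esumT; last by move=> i; exact: nneseries_ge0.
    transitivity (\esum_(i in [set: nat]) \esum_(j in [set: nat]) v (i, j))%E.
      rewrite esum_esum//; congr esum; exact/seteqP.
    by apply: eq_esum => i _; rewrite nneseries_esumT.
  apply: lee_nneseries => [i _ _|i _]; first exact: nneseries_ge0.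
  exact: (PG i).2.
rewrite (@reindex_esum _ _ _ setT setT f)//.
rewrite -nneseries_esumT//; apply: (@lebn_le_cover _ _
  (fun k => (G (f k).1).1 (f k).2) (fun k => (G (f k).1).2 (f k).2)).
split=> [k i|x /AF[i _] /(PG i).1.2[j _ xij]]; first exact: (PG (f k).1).1.1.
by exists (f^-1%FUN (i, j)) => //; rewrite invK ?inE.
Qed.

End outer.

Section lebesgue_tuple.
Context {R : realType} (n : nat).
Local Notation Rn := (n.+1.-tuple R).

Lemma lebn_box_le (A : set Rn) (a b : 'I_n.+1 -> R) : (forall i, a i <= b i) ->
  A `<=` box a b -> (lebn A <= (bvol a b)%:E)%E.
Proof.
move=> ab Aab; pose a' k := if k is 0%N then a else fun=> 0.
pose b' k := if k is 0%N then b else fun=> 0.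
apply: (le_trans (@lebn_le_cover _ _ A a' b' _)).
  by split=> [[|k] i//=|x /Aab ?]; exists 0%N.
rewrite nneseries_recl//; last first.
  by move=> [|k] _; rewrite lee_fin bvol_ge0//= => i; exact: ab.
rewrite eseries0 ?adde0// => -[|k]//= _ _; by rewrite bvol_degenerate.
Qed.

Lemma lebn0 : lebn (set0 : set Rn) = 0%E.
Proof.
apply/eqP; rewrite eq_le lebn_ge0 andbT.
by rewrite (le_trans (@lebn_box_le _ (fun=> 0) (fun=> 0) _ _))// bvol_degenerate.
Qed.

Let halfspace (i : 'I_n.+1) (c : R) : set Rn := [set x | tnth x i <= c].

(** Each box of a cover is cut along the hyperplane, and the volumes of the two halves add up. The
    clamps keep the sides ordered when the hyperplane misses the box: one half is then
    degenerate. *)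
Lemma lebn_halfspace (i : 'I_n.+1) (c : R) (X : set Rn) :
  (lebn (X `&` halfspace i c) + lebn (X `&` ~` halfspace i c)
   <= lebn X)%E.
Proof.
apply: le_ereal_inf_tmp => _ [a [b [ab [Xab ->]]]].
pose b1 k j := if j == i then Num.max (a k i) (Num.min (b k i) c) else b k j.
pose a2 k j := if j == i then Num.min (b k i) (Num.max (a k i) c) else a k j.
have ab1 k j : a k j <= b1 k j.
  by rewrite /b1; case: eqVneq => [->|_//]; rewrite le_max lexx.
have ab2 k j : a2 k j <= b k j.
  by rewrite /a2; case: eqVneq => [->|_//]; rewrite ge_min lexx.
apply: (@le_trans _ _ (\sum_(k <oo) (bvol (a k) (b1 k))%:E +
                       \sum_(k <oo) (bvol (a2 k) (b k))%:E)%E).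
  apply: leeD; apply: lebn_le_cover; split=> // x [/Xab[k _ xk] /= xc];
    exists k => // j; rewrite /b1/a2; case: eqVneq => [->|_]; try exact: xk;
    move/andP: (xk i) => [h1 h2].
    by rewrite h1 /= le_max le_min h2 xc orbT.
  by rewrite h2 andbT ge_min ge_max h1/= (ltW (_ : c < _)) ?orbT // ltNge; exact/negP.
rewrite -nneseriesD; last 2 first.
  by move=> k _ _; rewrite lee_fin bvol_ge0.
  by move=> k _ _; rewrite lee_fin bvol_ge0.
apply: lee_nneseries => k _; first by rewrite adde_ge0 ?lee_fin ?bvol_ge0.
rewrite -EFinD lee_fin /bvol (bigD1 i)//= [X in _ + X](bigD1 i)//= [leRHS](bigD1 i)//=.
rewrite (eq_bigr (fun j => b k j - a k j)); last first.
  by move=> j ji; rewrite /b1 (negbTE ji).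
rewrite [X in _ + _ * X](eq_bigr (fun j => b k j - a k j)); last first.
  by move=> j ji; rewrite /a2 (negbTE ji).
rewrite -mulrDl /b1 /a2 eqxx ler_wpM2r//.
  by apply: prodr_ge0 => j _; rewrite subr_ge0.
have := ab k i; rewrite /Num.max /Num.min; do !case: ifPn; rewrite -?leNgt; lra.
Qed.

Lemma lebn_le (A B : set Rn) : A `<=` B -> (lebn A <= lebn B)%E.
Proof.
move=> AB; apply: ereal_inf_le_tmp => _ [a [b [ab [Bab ->]]]].
by exists a, b; split => //; split => //; exact: subset_trans Bab.
Qed.

HB.instance Definition _ := @isOuterMeasure.Build R Rn (@lebn R n.+1) lebn0
  (@lebn_ge0 R n.+1) lebn_le (fun F => lebn_subset_subadditive (@subset_refl _ _)).

(** The product sigma-algebra is generated by preimages of rays under the coordinates, so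
    half-spaces suffice. *)
Lemma borel_caratheodory (A : set Rn) : measurable A ->
  caratheodory_measurable (@lebn R n.+1) A.
Proof.
have sC : sigma_algebra setT (caratheodory_measurable (@lebn R n.+1)).
  split; first exact: caratheodory_measurable_set0.
    by move=> B mB; rewrite setTD; exact: caratheodory_measurable_setC.
  exact: caratheodory_measurable_bigcup.
move: A; apply: smallest_sub => // A.
rewrite -bigcup_mkord_ord => -[k _] [B mB <-{A}]; rewrite setTI.
set i := inord k; clearbody i.
move: B mB; rewrite -[X in forall B, X B -> _]/(@ocitv R).-sigma.-measurable.
rewrite (RGenOInfty.measurableE R).
pose G := [set B : set R | caratheodory_measurable (@lebn R n.+1) ((@tnth _ _)^~ i @^-1` B)].
suff H : <<s @RGenOInfty.G R>> `<=` G by exact: H.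
apply: smallest_sub.
  split.
  - by rewrite /G/= preimage_set0; case: sC.
  - move=> B GB; rewrite /G/= setTD preimage_setC.
    exact: caratheodory_measurable_setC.
  - by move=> F GF; rewrite /G/= preimage_bigcup; case: sC => _ _; exact.
move=> _ [c ->]; rewrite /G/=.
rewrite (_ : _ @^-1` _ = ~` halfspace i c); last first.
  apply/seteqP; split=> x /=; rewrite in_itv/= andbT ltNge => /negP//.
apply: caratheodory_measurable_setC.
by apply: le_caratheodory_measurable => X; exact: lebn_halfspace.
Qed.

End lebesgue_tuple.

Section lebesgue_measure_tuple.
Context {R : realType} (n : nat).
Local Notation Rn := (n.+1.-tuple R).

Definition leb (A : set Rn) : \bar R := lebn A.

Let leb_sigma_additive : semi_sigma_additive leb.
Proof.
move=> F mF tF mUF.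
apply: (@caratheodory_measure_sigma_additive R Rn (@lebn R n.+1)) => //.
  by move=> i; exact: borel_caratheodory.
exact: borel_caratheodory.
Qed.

HB.instance Definition _ := isMeasure.Build _ _ _ leb
  (@lebn0 R n) (@lebn_ge0 R n.+1) leb_sigma_additive.

Lemma measurable_box (a b : 'I_n.+1 -> R) : measurable (box a b : set Rn).
Proof.
rewrite (_ : box a b = \bigcap_(i in [set: 'I_n.+1])
   ((fun x : Rn => tnth x i) @^-1` `[a i, b i])).
  apply: fin_bigcap_measurable => // i _.
  rewrite -[X in measurable X]setTI; exact: (measurable_tnth i).
by apply/seteqP; split => x /= xab i => [_|]; [rewrite /= in_itv/=|have /= := xab i I; rewrite in_itv].
Qed.

Lemma leb_box_le (a b : 'I_n.+1 -> R) : (forall i, a i <= b i) ->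
  (leb (box a b) <= (bvol a b)%:E)%E.
Proof. by move=> ab; exact: lebn_box_le. Qed.

Let leb_sigma_finite : sigma_finite setT leb.
Proof.
exists (fun k => box (fun=> - k%:R) (fun=> k%:R)).
  apply/seteqP; split => // x _.
  exists (\sum_(i < n.+1) Num.truncn `|tnth x i|).+1%N => // i.
  rewrite -ler_norml; apply: ltW; rewrite (lt_le_trans (truncnS_gt _))//.
  by rewrite ler_nat ltnS (bigD1 i)//= leq_addr.
move=> k; split; first exact: measurable_box.
rewrite (le_lt_trans (leb_box_le _)) ?ltey// => i.
by rewrite (le_trans (_ : _ <= 0)) ?oppr_le0.
Qed.

HB.instance Definition _ := Measure_isSigmaFinite.Build _ _ _ leb leb_sigma_finite.

Definition boxes : set (set Rn) := [set A | exists a b, A = box a b].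

Lemma boxes_setI : setI_closed boxes.
Proof.
move=> _ _ [a [b ->]] [c [d ->]].
exists (fun i => Num.max (a i) (c i)), (fun i => Num.min (b i) (d i)).
apply/seteqP; split => x /=.
  by move=> [h1 h2] i; rewrite ge_max le_min; move: (h1 i) (h2 i) => /andP[-> ->] /andP[-> ->].
by move=> h; split=> i; move: (h i); rewrite ge_max le_min => /andP[] /andP[h1 h2] /andP[h3 h4]; rewrite ?h1 ?h2 ?h3 ?h4.
Qed.

Lemma measurable_boxesE : (measurable : set (set Rn)) = <<s boxes>>.
Proof.
apply/seteqP; split; last first.
  apply: smallest_sub; first exact: sigma_algebra_measurable.
  by move=> _ [a [b ->]]; exact: measurable_box.
have sC := @smallest_sigma_algebra _ [set: Rn] boxes.
apply: smallest_sub => // A.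
rewrite -bigcup_mkord_ord => -[k _] [B mB <-{A}]; rewrite setTI.
set i := inord k; clearbody i.
move: B mB; rewrite -[X in forall B, X B -> _]/(@ocitv R).-sigma.-measurable.
rewrite (RGenOInfty.measurableE R).
pose G := [set B : set R | <<s boxes>> ((fun x : Rn => tnth x i) @^-1` B)].
suff H : <<s @RGenOInfty.G R>> `<=` G by exact: H.
have sG : sigma_algebra setT G.
  case: sC => h1 h2 h3; split.
  - by rewrite /G/= preimage_set0.
  - by move=> B GB; rewrite /G/= setTD preimage_setC -setTD; exact: h2.
  - by move=> F GF; rewrite /G/= preimage_bigcup; exact: h3.
apply: smallest_sub => // _ [c ->]; rewrite /G/=.
(* An open half-space is exhausted by boxes that stay 1/(k+1) away from its boundary and are bounded
   by k elsewhere. *)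
rewrite (_ : _ @^-1` _ = \bigcup_k box
   (fun j => if j == i then c + k.+1%:R^-1 else - k%:R) (fun=> k%:R)).
  by case: sC => _ _; apply=> m; apply: sub_sigma_algebra; eexists; eexists.
apply/seteqP; split=> x /=; rewrite in_itv/= andbT; last first.
  move=> [m _] /(_ i); rewrite eqxx => /andP[+ _].
  by apply: lt_le_trans; rewrite ltrDl invr_gt0 ltr0n.
move=> cx; pose m1 := Num.truncn (tnth x i - c)^-1.
exists (m1 + (\sum_(i < n.+1) Num.truncn `|tnth x i|).+1)%N => // j.
have h : `|tnth x j| <= (m1 + (\sum_(i < n.+1) Num.truncn `|tnth x i|).+1)%:R.
  apply: ltW; rewrite (lt_le_trans (truncnS_gt _))//.
  by rewrite ler_nat (bigD1 j)//= addnS ltnS addnCA leq_addr.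
move: (h); rewrite ler_norml => /andP[h1 h2]; rewrite h2 andbT.
case: eqP => // ->; rewrite -lerBrDl -[leRHS]invrK lef_pV2 ?posrE ?ltr0n ?invr_gt0 ?subr_gt0//.
rewrite (le_trans (ltW (truncnS_gt _)))// ler_nat -/m1; lia.
Qed.

(** On boxes only the upper bound for [leb] is known so far. Subadditivity along covers gives m <=
    leb on measurable sets, so both agree on boxes, which form a generating pi-system. The exact
    volume of a box then comes from exhibiting one such measure [m], with no compactness argument
    about covers. *)
Lemma leb_unique (m : {measure set Rn -> \bar R}) :
  (forall a b, (forall i, a i <= b i) -> m (box a b) = (bvol a b)%:E) ->
  forall A, measurable A -> leb A = m A.
Proof.
move=> mbox.
have lem A : measurable A -> (m A <= leb A)%E.
  move=> mA; apply: le_ereal_inf_tmp => _ [a [b [ab [Aab ->]]]].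
  rewrite (@eq_eseriesr _ _ (fun k => m (box (a k) (b k)))); last first.
    by move=> k _; rewrite mbox.
  by apply: measure_sigma_subadditive => // k; exact: measurable_box.
apply: (@measure_unique _ _ _ boxes (fun k => box (fun=> - k%:R) (fun=> k%:R))).
- exact: measurable_boxesE.
- exact: boxes_setI.
- by move=> k; eexists; eexists.
- apply/seteqP; split => // x _.
  exists (\sum_(i < n.+1) Num.truncn `|tnth x i|).+1%N => // i.
  rewrite -ler_norml; apply: ltW; rewrite (lt_le_trans (truncnS_gt _))//.
  by rewrite ler_nat ltnS (bigD1 i)//= leq_addr.
- move=> _ [a [b ->]]; have [ab|/existsNP[i /negP]] := pselect (forall i, a i <= b i).
    apply/eqP; rewrite eq_le lem ?andbT; last exact: measurable_box.
    by rewrite mbox// leb_box_le.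
  rewrite -ltNge => ba; rewrite (_ : box a b = set0) ?measure0//.
  apply/seteqP; split => // x /(_ i) /andP[h1 h2].
  by have := le_lt_trans (le_trans h1 h2) ba; rewrite ltxx.
- move=> k; rewrite (le_lt_trans (leb_box_le _)) ?ltey// => i.
  by rewrite (le_trans (_ : _ <= 0)) ?oppr_le0.
Qed.

End lebesgue_measure_tuple.

(** * Identification with iterated products of one-dimensional Lebesgue measure *)

Section lebesgue_product.
Context {R : realType}.

Definition tcons n (p : measurableTypeR R * n.-tuple R) : n.+1.-tuple R :=
  [tuple of p.1 :: p.2].

Lemma measurable_tcons n : measurable_fun setT (@tcons n).
Proof. exact: (@measurable_cons _ _ _ _ fst n snd). Qed.

Lemma tnth_tcons0 n p : tnth (@tcons n p) ord0 = p.1.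
Proof. by []. Qed.

Lemma tnth_tconsS n p i : tnth (@tcons n p) (lift ord0 i) = tnth p.2 i.
Proof. by rewrite tnthS. Qed.

Definition tprod n (S : 'I_n -> set R) : set (n.-tuple R) :=
  [set x | forall i, S i (tnth x i)].

Lemma preimage_tcons n (S : 'I_n.+1 -> set R) :
  @tcons n @^-1` tprod S = S ord0 `*` tprod (fun i => S (lift ord0 i)).
Proof.
apply/seteqP; split=> [[x y] h|[x y] [/= h0 h] i].
  by split=> [|i]/=; [exact: (h ord0)|rewrite -(tnth_tconsS (x, y)); exact: h].
case: (fintype.unliftP ord0 i) => [j ->|->//].
  rewrite tnth_tconsS; exact: h.
Qed.

Lemma measurable_tprod n (S : 'I_n -> set R) : (forall i, measurable (S i)) ->
  measurable (tprod S).
Proof.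
move=> mS; rewrite (_ : tprod S = \bigcap_(i in [set: 'I_n])
   ((fun x : n.-tuple R => tnth x i) @^-1` S i)).
  apply: fin_bigcap_measurable => // i _.
  by rewrite -[X in measurable X]setTI; exact: (measurable_tnth i).
by apply/seteqP; split => [x xS i _|x xS i]; [exact: xS|exact: (xS i I)].
Qed.

Lemma boxE n (a b : 'I_n -> R) : box a b = tprod (fun i => `[a i, b i]%classic).
Proof. by apply/seteqP; split=> x h i; have := h i; rewrite /= in_itv. Qed.

Lemma lebesgue_itvcc (a b : R) : a <= b ->
  lebesgue_measure (`[a, b]%classic : set R) = (b - a)%:E.
Proof.
rewrite lebesgue_measure_itv /= lte_fin le_eqVlt => /predU1P[->|->//].
by rewrite ltxx subrr.
Qed.

Let tsing (x : measurableTypeR R) : 1.-tuple R := [tuple x].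

Let measurable_tsing : measurable_fun setT tsing.
Proof.
by apply/measurable_fun_tnthP => i; rewrite (_ : _ \o _ = id)//; apply/funext => x /=; rewrite ord1.
Qed.

Let lebesgue_preimage_tsing (a b : 'I_1 -> R) : (forall i, a i <= b i) ->
  lebesgue_measure (tsing @^-1` box a b) = (bvol a b)%:E.
Proof.
move=> ab; rewrite (_ : tsing @^-1` _ = `[a ord0, b ord0]%classic).
  by rewrite lebesgue_itvcc// /bvol big_ord1.
apply/seteqP; split=> x; first by move=> /(_ ord0); rewrite /= in_itv.
by rewrite /= in_itv/= => h i; rewrite ord1.
Qed.

Lemma leb1E (A : set (1.-tuple R)) : measurable A ->
  leb A = lebesgue_measure (tsing @^-1` A).
Proof.
move: A; apply: (@leb_unique _ _ (pushforward lebesgue_measure tsing)) => a b ab.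
exact: lebesgue_preimage_tsing.
Qed.

Let push_box n (a b : 'I_n.+2 -> R) :
  (forall a b : 'I_n.+1 -> R, (forall i, a i <= b i) -> leb (box a b) = (bvol a b)%:E) ->
  (forall i, a i <= b i) ->
  pushforward (lebesgue_measure \x (@leb R n))%E (@tcons n.+1) (box a b) = (bvol a b)%:E.
Proof.
move=> IH ab; rewrite -[LHS]/((lebesgue_measure \x (@leb R n))%E (@tcons n.+1 @^-1` box a b)) boxE preimage_tcons product_measure1E//; last first.
  exact: measurable_tprod.
transitivity (lebesgue_measure (`[a ord0, b ord0]%classic : set R) *
  leb (box (fun i : 'I_n.+1 => a (lift ord0 i)) (fun i => b (lift ord0 i))))%E.
  by rewrite [in RHS]boxE.
by rewrite lebesgue_itvcc// IH// -EFinM /bvol [in RHS]big_ord_recl.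
Qed.

Lemma leb_box n (a b : 'I_n.+1 -> R) : (forall i, a i <= b i) ->
  leb (box a b) = (bvol a b)%:E.
Proof.
elim: n a b => [|n IH] a b ab.
  rewrite leb1E; [exact: lebesgue_preimage_tsing|exact: measurable_box].
rewrite (@leb_unique _ _ (pushforward (lebesgue_measure \x (@leb R n))%E (@tcons n.+1)))//.
- exact: measurable_tcons.
- by move=> mt; exact: push_box.
- by move=> c d cd; exact: push_box.
- exact: measurable_box.
Qed.

Lemma leb_consE n (A : set (n.+2.-tuple R)) : measurable A ->
  leb A = (lebesgue_measure \x (@leb R n))%E (@tcons n.+1 @^-1` A).
Proof.
move: A; apply: (@leb_unique _ _ (pushforward (lebesgue_measure \x (@leb R n))%E (@tcons n.+1))).
  exact: measurable_tcons.
by move=> mt a b ab; apply: push_box => //; exact: leb_box.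
Qed.

Lemma leb_tprod n (S : 'I_n.+1 -> set R) : (forall i, measurable (S i)) ->
  leb (tprod S) = (\prod_(i < n.+1) lebesgue_measure (S i))%E.
Proof.
elim: n S => [|n IH] S mS.
  rewrite leb1E; last exact: measurable_tprod.
  rewrite big_ord1; congr lebesgue_measure; apply/seteqP; split=> x /=.
    exact.
  by move=> h i; rewrite ord1.
rewrite leb_consE; last exact: measurable_tprod.
rewrite preimage_tcons product_measure1E; first last.
- by apply: measurable_tprod => i; exact: mS.
- exact: (mS ord0).
rewrite [RHS]big_ord_recl; congr (_ * _)%E; exact: IH.
Qed.

End lebesgue_product.

Section fubini_first.
Context {R : realType}.

Lemma integrable_bounded d (T : measurableType d) (mu : {measure set T -> \bar R})
    (D : set T) (F : T -> R) (c : R) :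
  measurable D -> (mu D < +oo)%E -> measurable_fun setT F ->
  (forall x, `|F x| <= c) -> mu.-integrable D (EFin \o F).
Proof.
move=> mD Dfin mF Fc; apply: measurable_bounded_integrable => //.
  exact: measurable_funS mF.
exists c; split; rewrite ?num_real// => M cM x _; exact: le_trans (Fc x) (ltW cM).
Qed.

(** Fubini with the first coordinate innermost: all the cancellation is sought there, and the other
    coordinates contribute only their volume [v]. *)
Lemma integral_first_coordinate n (S : 'I_n.+2 -> set R) (F : n.+2.-tuple R -> R) (kappa v c : R) :
  (forall i, measurable (S i)) -> (lebesgue_measure (S ord0) < +oo)%E ->
  (\prod_(i < n.+1) lebesgue_measure (S (lift ord0 i)) = v%:E)%E ->
  measurable_fun setT F -> (forall x, `|F x| <= c) -> 0 <= kappa ->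
  (forall y : n.+1.-tuple R,
     (`| \int[lebesgue_measure]_(x in S ord0) (F (tcons (x, y)))%:E | <= kappa%:E)%E) ->
  (`| \int[@leb R n.+1]_(x in tprod S) (F x)%:E | <= (kappa * v)%:E)%E.
Proof.
move=> mS S0fin S'v mF Fc k0 Fk.
have mD : measurable (tprod S) by exact: measurable_tprod.
have mS' : measurable (tprod (fun i => S (lift ord0 i))).
  by apply: measurable_tprod => i; exact: mS.
set S' := tprod _ in mS'.
have lebS' : leb S' = v%:E by rewrite leb_tprod => // i; exact: mS.
have mG : measurable_fun setT (F \o @tcons R n.+1) by apply: measurableT_comp => //; exact: measurable_tcons.
pose D : set (measurableTypeR R * n.+1.-tuple R) := S ord0 `*` S'.
have mSS' : measurable D by apply: measurableX => //; exact: (mS ord0).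
have DE : D = @tcons R n.+1 @^-1` tprod S by rewrite preimage_tcons.
have SSfin : ((lebesgue_measure \x (@leb R n))%E (D) < +oo)%E.
  rewrite /D product_measure1E//; last exact: (mS ord0).
  rewrite [X in (_ * X)%E](_ : _ = v%:E)//.
  by apply: lte_mul_pinfty; rewrite ?ltry// ge0_fin_numE.
have iG : (lebesgue_measure \x (@leb R n))%E.-integrable (D)
    (EFin \o (F \o @tcons R n.+1)).
  by apply: integrable_bounded => // x; exact: Fc.
have -> : (\int[@leb R n.+1]_(x in tprod S) (F x)%:E =
   \int[(lebesgue_measure \x (@leb R n))%E]_(z in D) (F (tcons z))%:E)%E.
  rewrite DE.
  rewrite -(@integral_pushforward _ _ _ _ _ (@tcons R n.+1) _ _ _ (EFin \o F))//.
  - apply: eq_measure_integral => [|mt A mA _]; [exact: measurable_tcons|exact: leb_consE].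
  - exact: measurable_tcons.
  - exact/measurable_EFinP.
  - by rewrite -DE.
have iGT : (lebesgue_measure \x (@leb R n))%E.-integrable setT
    ((EFin \o (F \o @tcons R n.+1)) \_ (D)).
  by rewrite -(@integrable_mkcond _ _ _ _ D).
have mfG := measurable_fubini_G iGT.
rewrite integral_mkcond -integral21_prod_meas1//=.
apply: (le_trans (le_abse_integral _ _ _)) => //.
rewrite EFinM -lebS' -integral_cst//.
rewrite [leRHS]integral_mkcond; apply: ge0_le_integral => //.
- exact: measurableT_comp.
- by apply/(@measurable_restrictT _ _ _ _ S') => //; exact: measurable_cst.
move=> y _; rewrite patchE; case: ifPn => yS'.
  rewrite /fubini_G (_ : (\int[_]_x _ = \int[lebesgue_measure]_(x in S ord0) (F (tcons (x, y)))%:E)%E)//.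
  rewrite [RHS]integral_mkcond; apply: eq_integral => x _; rewrite !patchE.
  by rewrite in_setX/= yS' andbT.
rewrite /fubini_G integral0_eq ?abse0// => x _; rewrite patchE in_setX/= (negbTE yS').
by rewrite andbF.
Qed.

End fubini_first.

(** * Nonstationary phase *)

Section quadratic_oscillation.
Context {R : realType} (al be ga : R).

Let ph (y : R) : R := al * y ^+ 2 + be * y + ga.
Let dph (y : R) : R := 2 * al * y + be.

Let is_derive_dph (y : R) : is_derive y 1 dph (2 * al).
Proof.
have -> : dph = (2 * al) \*: (id : R -> R) + cst be.
  by apply/funext => z; rewrite /dph /= /GRing.scale.
by apply: is_derive_eq; rewrite addr0 /GRing.scale /= mulr1.
Qed.

Let is_derive_ph (y : R) : is_derive y 1 ph (dph y).
Proof.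
have -> : ph = al \*: ((id : R -> R) ^+ 2) + be \*: (id : R -> R) + cst ga.
  by apply/funext => z; rewrite /ph /= /GRing.scale.
by apply: is_derive_eq; rewrite addr0 /GRing.scale /dph /=; ring.
Qed.

(** Approximate primitive of [cos (ph y)], as produced by one integration by parts; its derivative
    is off by sin(ph) ph'' / ph'^2. *)
Let psi (y : R) : R := sin (ph y) * (dph y)^-1.
Let dpsi (y : R) : R := cos (ph y) - sin (ph y) * (2 * al) * (dph y) ^- 2.

Let is_derive_psi (y : R) : dph y != 0 -> is_derive y 1 psi (dpsi y).
Proof.
move=> dy0.
have h1 : is_derive y 1 (sin \o ph) (cos (ph y) * dph y) by apply: is_derive1_comp.
have h2 := is_deriveV dy0 (is_derive_dph y).
have -> : psi = (sin \o ph) * (fun y => (dph y)^-1) by [].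
apply: is_derive_eq; rewrite /GRing.scale /= /dpsi; field.
exact: dy0.
Qed.

Let continuous_ph : continuous ph.
Proof. by move=> y; apply/differentiable_continuous/derivable1_diffP. Qed.

Let continuous_dph : continuous dph.
Proof. by move=> y; apply/differentiable_continuous/derivable1_diffP. Qed.

Let continuous_cosph : continuous (fun y => cos (ph y)).
Proof. by move=> y; apply: (@continuous_comp _ _ _ ph cos); [exact: continuous_ph|exact: continuous_cos]. Qed.

Let continuous_sinph : continuous (fun y => sin (ph y)).
Proof. by move=> y; apply: (@continuous_comp _ _ _ ph sin); [exact: continuous_ph|exact: continuous_sin]. Qed.

(** The values of [psi] at the two ends give 2 / lam, and the defect of the approximate primitive is
    bounded pointwise by 2 |al| / lam^2. *)
Lemma quadratic_oscillation (a b lam : R) : 0 < lam -> a <= b ->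
  (forall y, a <= y <= b -> lam <= `|2 * al * y + be|) ->
  (`|\int[lebesgue_measure]_(y in `[a, b]) (cos (al * y ^+ 2 + be * y + ga))%:E| <=
   (2 / lam + (b - a) * (2 * `|al| / lam ^+ 2))%:E)%E.
Proof.
move=> lam0; rewrite le_eqVlt => /predU1P[<- _|ab dphE].
  rewrite set_itv1 integral_set1 abse0 lee_fin subrr mul0r addr0.
  by rewrite divr_ge0// ltW.
have dph0 y : a <= y <= b -> dph y != 0.
  by move=> /dphE h; rewrite -normr_gt0 (lt_le_trans lam0).
have cpsi y : a <= y <= b -> {for y, continuous psi}.
  move=> yab; apply/differentiable_continuous/derivable1_diffP.
  by have [] := is_derive_psi (dph0 y yab).
have cdpsi : {within `[a, b], continuous dpsi}.
  apply: continuous_in_subspaceT => y; rewrite inE/= in_itv/= => yab.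
  apply: cvgB; first exact: continuous_cosph.
  apply: cvgM; first by apply: cvgM; [exact: continuous_sinph|exact: cvg_cst].
  apply: cvgV; first by rewrite expf_neq0// dph0.
  by apply: cvgM; exact: continuous_dph.
have FTC : (\int[lebesgue_measure]_(y in `[a, b]) (dpsi y)%:E = (psi b - psi a)%:E)%E.
  rewrite (continuous_FTC2 ab cdpsi (F := psi)) ?EFinB//.
    split.
    - move=> y; rewrite in_itv/= => /andP[ay yb].
      by have [] := is_derive_psi (dph0 y _); rewrite // ?ltW.
    - by apply: cvg_at_right_filter; apply: cpsi; rewrite lexx ltW.
    - by apply: cvg_at_left_filter; apply: cpsi; rewrite lexx ltW.
  move=> y; rewrite in_itv/= => /andP[ay yb]; rewrite derive1E.
  by have [] := is_derive_psi (dph0 y _); rewrite // ?ltW.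
have mE : measurable (`[a, b]%classic : set R) by [].
have ccos : {within `[a, b], continuous (fun y => cos (ph y))}.
  exact: continuous_subspaceT.
have icos := continuous_compact_integrable (@segment_compact _ a b) ccos.
have idpsi := continuous_compact_integrable (@segment_compact _ a b) cdpsi.
pose M := 2 * `|al| / lam ^+ 2.
have dphi y : a <= y <= b -> `|(dph y)^-1| <= lam^-1.
  by move=> yab; rewrite normfV lef_pV2 ?posrE ?dphE// normr_gt0 dph0.
have err y : a <= y <= b -> `|cos (ph y) - dpsi y| <= M.
  move=> yab; rewrite /dpsi opprB addrC subrK -exprVn normrM normrX normrM [`|2 * al|]normrM.
  rewrite -[leRHS]mul1r /M -mulrA; apply: ler_pM => //.
    by rewrite sin_max.
  rewrite [`|2|]ger0_norm//; apply: ler_pM => //; rewrite -?exprVn.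
  by rewrite lerXn2r ?nnegrE ?invr_ge0 ?(ltW lam0) ?dphi.
have -> : (\int[lebesgue_measure]_(y in `[a, b]) (cos (al * y ^+ 2 + be * y + ga))%:E =
  \int[lebesgue_measure]_(y in `[a, b]) (dpsi y)%:E +
  \int[lebesgue_measure]_(y in `[a, b]) (cos (ph y) - dpsi y)%:E)%E.
  rewrite -integralD//=; last exact: (integrableB _ icos idpsi).
  by apply: eq_integral => y _; congr _%:E; rewrite /ph; ring.
rewrite FTC [leRHS]EFinD; apply: (le_trans (lee_abs_add _ _)); apply: leeD.
  rewrite lee_fin (le_trans (ler_normB _ _))// mulr_natl mulr2n lerD// /psi normrM.
    by rewrite -[leRHS]mul1r ler_pM ?normr_ge0 ?sin_max ?dphi ?lexx ?(ltW ab).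
  by rewrite -[leRHS]mul1r ler_pM ?normr_ge0 ?sin_max ?dphi ?lexx ?(ltW ab).
apply: le_trans (le_abse_integral _ _ _) _ => //.
  by apply: measurable_int; exact: (integrableB _ icos idpsi).
rewrite -/M mulrC EFinM -(lebesgue_itvcc (ltW ab)) -integral_cst//.
apply: ge0_le_integral => //=.
- apply/measurable_EFinP; apply: measurableT_comp => //; apply/measurable_EFinP.
  by apply: measurable_int; exact: (integrableB _ icos idpsi).
Qed.

End quadratic_oscillation.

(** * Cantor sets and Hausdorff dimension *)

Section cantor.
Context {R : realType} (eta rho : nat -> R).
Hypothesis eta_gt0 : forall k, 0 < eta k.
Hypothesis rho_gt0 : forall k, 0 < rho k.
Hypothesis rho_le_eta : forall k, rho k <= eta k.
Hypothesis eta_le_rho : forall k, 4 * eta k.+1 <= rho k.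

(** Number of children of an interval of generation k. The factor 2 keeps their left ends in the
    first half of the parent interval: the other half holds the interval of the last child and
    separates the children of neighbouring parents. *)
Definition cantor_branching k : nat := Num.truncn (rho k / (2 * eta k.+1)).
Local Notation m := cantor_branching.

Definition cantor_count k : nat := (\prod_(l < k) m l)%N.
Local Notation M := cantor_count.

(** Left end of the interval of index N in generation k. In mixed radix, [N %/ m k'] is the index of
    the parent and [N %% m k'] the rank among its children; the floor plus one moves the left end of
    the parent to the next multiple of [eta k]. The origin 1 bounds the coordinates below, so that
    resonant times will be comparable to 1/T. *)
Fixpoint cantor_point k (N : nat) : R :=
  if k is k'.+1 then
    eta k * ((Num.truncn (cantor_point k' (N %/ m k') / eta k)).+1 + N %% m k')%:R
  else 1 + eta 0 * N%:R.
Local Notation Y := cantor_point.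

Let ratio_ge2 k : 2 <= rho k / (2 * eta k.+1).
Proof. by rewrite ler_pdivlMr ?mulr_gt0//; have := eta_le_rho k; lra. Qed.

Lemma branching_bounds k :
  (1 < m k)%N /\ (m k)%:R * (2 * eta k.+1) <= rho k /\
  (m k)%:R^-1 <= 4 * eta k.+1 / rho k.
Proof.
have v2 := ratio_ge2 k; have v0 : 0 <= rho k / (2 * eta k.+1) by lra.
have mle : (m k)%:R <= rho k / (2 * eta k.+1) by rewrite truncn_le.
have mgt : rho k / (2 * eta k.+1) < (m k).+1%:R by exact: truncnS_gt.
have m1 : (1 < m k)%N.
  by rewrite -ltnS -(@ltr_nat R); exact: le_lt_trans mgt.
split=> //; split; first by rewrite -ler_pdivlMr ?mulr_gt0.
have -> : 4 * eta k.+1 / rho k = (rho k / (2 * eta k.+1) / 2)^-1.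
  by field; rewrite !gt_eqF.
rewrite lef_pV2 ?posrE ?divr_gt0 ?mulr_gt0 ?ltr0n//; last by rewrite ltnW.
have : (2:R) <= (m k)%:R by rewrite ler_nat.
by move: mgt; rewrite -[(m k).+1%:R]natr1; lra.
Qed.

Let m_gt0 k : (0 < m k)%N.
Proof. by have [/ltnW] := branching_bounds k. Qed.

Lemma cantor_count_gt0 k : (0 < M k)%N.
Proof. by rewrite /M prodn_gt0. Qed.

Lemma cantor_countS k : M k.+1 = (M k * m k)%N.
Proof. by rewrite /M big_ord_recr. Qed.

Lemma cantor_point_ge1 k N : 1 <= Y k N.
Proof.
elim: k N => [|k IH] N /=; first by rewrite lerDl mulr_ge0 ?ler0n// ltW.
refine (le_trans (IH (N %/ m k)%N) _).
rewrite mulrC -ler_pdivrMr// (le_trans (ltW (truncnS_gt _)))// ler_nat.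
by rewrite leq_addr.
Qed.

Lemma cantor_pointS k N :
  Y k (N %/ m k) <= Y k.+1 N <= Y k (N %/ m k) + (m k)%:R * eta k.+1.
Proof.
rewrite /=; set y := Y k _; set t := Num.truncn _; set d := (N %% m k)%N.
have y0 : 0 <= y / eta k.+1.
  by rewrite divr_ge0 ?(ltW (eta_gt0 _))// (le_trans ler01)// cantor_point_ge1.
have tle : t%:R <= y / eta k.+1 by rewrite truncn_le.
have tgt : y / eta k.+1 < t.+1%:R by exact: truncnS_gt.
have dm : (d.+1)%:R <= (m k)%:R :> R by rewrite ler_nat ltn_mod m_gt0.
have d0 : 0 <= d%:R :> R by [].
rewrite mulrC natrD -ler_pdivrMr//; apply/andP; split; first by lra.
rewrite -[y](divfK (negbT (gt_eqF (eta_gt0 k.+1)))) -mulrDl ler_pM2r//.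
by move: dm tle; rewrite -!natr1; lra.
Qed.

(** Siblings are exactly eta apart. Otherwise the parents are, by induction, at least eta k >= rho k
    >= 2 (m k) eta k.+1 apart per index; half of this is what the children need, and the other half
    covers the rounding to the lattice. *)
Lemma cantor_point_gap k N N' : (N <= N')%N ->
  Y k N + eta k * (N' - N)%:R <= Y k N'.
Proof.
elim: k N N' => [|k IH] N N' NN'.
  by rewrite /= natrB//; lra.
rewrite [in leRHS](divn_eq N' (m k)) [in leLHS](divn_eq N (m k)).
set q' := (N' %/ m k)%N; set q := (N %/ m k)%N.
set d' := (N' %% m k)%N; set d := (N %% m k)%N.
have d'm : (d' < m k)%N by rewrite ltn_mod.
have dm : (d < m k)%N by rewrite ltn_mod.
have qq' : (q <= q')%N by exact: leq_div2r.
have e0 := eta_gt0 k.+1.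
have YE (a b : nat) : (b < m k)%N -> Y k.+1 (a * m k + b) =
    eta k.+1 * ((Num.truncn (Y k a / eta k.+1)).+1 + b)%:R.
  move=> bm; rewrite /= divnMDl ?m_gt0// (divn_small bm) addn0.
  by rewrite modnMDl modn_small.
have NN'E : (N' - (q * m k + d))%:R = (q' * m k + d')%:R - (q * m k + d)%:R :> R.
  by rewrite -!divn_eq natrB.
rewrite NN'E !YE// !natrD !natrM; set x := (q' : nat)%:R; set z := (q : nat)%:R.
move: qq'; rewrite leq_eqVlt => /predU1P[E|ltqq'].
  rewrite /x /z E; nra.
have [_ [h _]] := branching_bounds k.
have := IH q q' (ltnW ltqq'); rewrite natrB ?(ltnW ltqq')// -/x -/z => IHq.
set t := Num.truncn _; set t' := Num.truncn _.
have xz : z + 1 <= x by rewrite /x /z natr1 ler_nat.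
have m1 : (1 : R) <= (m k)%:R by rewrite ler1n m_gt0.
have Yq0 : 0 <= Y k q / eta k.+1.
  by rewrite divr_ge0 ?(ltW e0)// (le_trans ler01)// cantor_point_ge1.
have tle : t%:R * eta k.+1 <= Y k q by rewrite -ler_pdivlMr// truncn_le.
have tgt : Y k q' < t'.+1%:R * eta k.+1 by rewrite -ltr_pdivrMr//; exact: truncnS_gt.
have re := rho_le_eta k.
have h2 : 2 * (m k)%:R * eta k.+1 * (x - z) <= eta k * (x - z).
  by rewrite ler_wpM2r ?subr_ge0; lra.
have h3 : eta k.+1 <= (m k)%:R * eta k.+1 * (x - z).
  rewrite -[leLHS]mul1r mulrAC ler_wpM2r ?(ltW e0)//; nra.
rewrite -!natr1 in tgt *; lra.
Qed.

Definition cantor_index k (s : R) : nat := Num.truncn (s * (M k)%:R).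
Local Notation I := cantor_index.

Lemma cantor_indexS k s : 0 <= s -> (I k.+1 s %/ m k)%N = I k s.
Proof.
move=> s0; apply/esym/eqP; rewrite truncn_eq ?mulr_ge0 ?ler0n//.
set N := I k.+1 s; set q := (N %/ m k)%N.
have NE := divn_eq N (m k); rewrite -/q in NE.
have Nlt : (N < (q + 1) * m k)%N by rewrite addn1 ltn_ceil.
have Nle : N%:R <= s * (M k.+1)%:R by rewrite truncn_le// mulr_ge0.
have Ngt : s * (M k.+1)%:R < N.+1%:R by exact: truncnS_gt.
have mk0 : 0 < (m k)%:R :> R by rewrite ltr0n.
have E : s * (M k)%:R * (m k)%:R = s * (M k.+1)%:R by rewrite cantor_countS natrM mulrA.
apply/andP; split.
  by rewrite -(ler_pM2r mk0) E (le_trans _ Nle)// -natrM ler_nat leq_trunc_div.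
by rewrite -(ltr_pM2r mk0) E (lt_le_trans Ngt)// -natrM ler_nat -[q.+1]addn1.
Qed.

Let z (s : R) k := Y k (I k s).

Let z_step s k : 0 <= s -> z s k <= z s k.+1 <= z s k + (m k)%:R * eta k.+1.
Proof. by move=> s0; rewrite /z -(cantor_indexS k s0); exact: cantor_pointS. Qed.

Let z_nondecreasing s : 0 <= s -> {homo z s : k l / (k <= l)%N >-> k <= l}.
Proof.
move=> s0; apply: homo_leq => // [y x w|k]; first exact: le_trans.
by have /andP[] := z_step k s0.
Qed.

Let z_rho s k l : 0 <= s -> (k <= l)%N -> z s l + rho l <= z s k + rho k.
Proof.
move=> s0; elim: l => [|l IH]; first by rewrite leqn0 => /eqP->.
rewrite leq_eqVlt => /predU1P[->//|/IH]; apply: le_trans.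
have /andP[_ h] := z_step l s0; have [_ [h1 _]] := branching_bounds l.
by have := eta_le_rho l; have := rho_le_eta l.+1; have := eta_gt0 l.+1; lra.
Qed.

(** The intervals [z s k, z s k + rho k] are nested, and this is their common point. *)
Definition cantor_fun (s : R) : R := sup (range (z s)).

Let cantor_fun_bounds s k : 0 <= s -> z s k <= cantor_fun s <= z s k + rho k.
Proof.
move=> s0; have ubk : ubound (range (z s)) (z s k + rho k).
  move=> _ [l _ <-]; have [kl|/ltnW lk] := leqP k l.
    by have := z_rho s0 kl; have := rho_gt0 l; lra.
  by have := z_nondecreasing s0 lk; have := rho_gt0 k; lra.
apply/andP; split.
  by apply: ub_le_sup; [exists (z s k + rho k)|exists k].
by apply: ge_sup => //; exists (z s k), k.
Qed.

Lemma cantor_fun_itv s : 0 <= s -> s < 1 -> 1 <= cantor_fun s <= 1 + rho 0.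
Proof.
move=> s0 s1; have := cantor_fun_bounds 0 s0; rewrite /z /I /M big_ord0 mulr1.
have -> : Num.truncn s = 0%N by apply/eqP; rewrite truncn_eq// s0.
by rewrite /= mulr0 addr0.
Qed.

Lemma cantor_fun_lattice s k : 0 <= s ->
  exists N : nat, eta k.+1 * N%:R <= cantor_fun s <= eta k.+1 * N%:R + rho k.+1.
Proof. by move=> s0; eexists; exact: (cantor_fun_bounds k.+1 s0). Qed.

(** Regularity of the inverse map. By the gap, the indices of generation k differ by at most 1 +
    distance / eta k; an index stands for a parameter interval of length 1 / M k, and truncation
    adds one more. *)
Lemma cantor_fun_modulus s s' k : 0 <= s -> 0 <= s' ->
  `|s - s'| <= (M k)%:R^-1 * (2 + `|cantor_fun s - cantor_fun s'| / eta k).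
Proof.
wlog ss' : s s' / s <= s'.
  move=> H s0 s'0; have [/H|/ltW /H] := leP s s'; first exact.
  by rewrite distrC (distrC (cantor_fun _)); exact.
move=> s0 s'0.
have Mk0 : 0 < (M k)%:R :> R by rewrite ltr0n cantor_count_gt0.
have II : (I k s <= I k s')%N by apply: le_truncn; rewrite ler_pM2r.
have gap := cantor_point_gap k II; rewrite natrB// in gap.
have /andP[a1 a2] := cantor_fun_bounds k s0.
have /andP[b1 b2] := cantor_fun_bounds k s'0.
have e0 := eta_gt0 k; have re := rho_le_eta k.
have h : (I k s')%:R - (I k s)%:R <= 1 + `|cantor_fun s - cantor_fun s'| / eta k.
  rewrite -lerBlDl ler_pdivlMr// distrC.
  by apply: le_trans (ler_norm _); rewrite /z in a1 a2 b1 b2; lra.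
rewrite distrC ger0_norm ?subr_ge0// mulrC ler_pdivlMr// mulrBl.
have h1 : s' * (M k)%:R < (I k s').+1%:R by exact: truncnS_gt.
have h2 : (I k s)%:R <= s * (M k)%:R by rewrite truncn_le// mulr_ge0.
by move: h1; rewrite -natr1; lra.
Qed.

Lemma cantor_count_invS k :
  (M k.+1)%:R^-1 <= (M k)%:R^-1 * (4 * eta k.+1 / rho k) :> R.
Proof.
rewrite cantor_countS natrM invfM ler_wpM2l ?invr_ge0//.
by have [_ []] := branching_bounds k.
Qed.

Lemma cantor_count_expn k : (2 ^ k <= M k)%N.
Proof.
elim: k => [|k IH]; first by rewrite /M big_ord0.
by rewrite cantor_countS expnSr leq_mul//; have [] := branching_bounds k.
Qed.

End cantor.

(** * A lower bound for the Hausdorff dimension *)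

Section hausdorff.
Context {R : realType} (n : nat).
Local Notation Rn := (n.+1.-tuple R).

Lemma coord_le_distn (x y : Rn) i : `|tnth x i - tnth y i| <= distn x y.
Proof.
rewrite -sqrtr_sqr ler_wsqrtr// (bigD1 i)//= lerDl.
by apply: sumr_ge0 => j _; rewrite sqr_ge0.
Qed.

Lemma diamn_bounds (U : set Rn) (delta : R) : U !=set0 -> (diamn U <= delta%:E)%E ->
  0 <= fine (diamn U) <= delta /\
  (forall x y, U x -> U y -> distn x y <= fine (diamn U)).
Proof.
move=> [x0 Ux0] Ud.
have h x y : U x -> U y -> ((distn x y)%:E <= diamn U)%E.
  by move=> Ux Uy; apply: ereal_sup_ubound => /=; exists x => //; exists y.
have d0 : (0 <= diamn U)%E.
  by apply: le_trans (h _ _ Ux0 Ux0); rewrite lee_fin sqrtr_ge0.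
have dfin : diamn U \is a fin_num by rewrite ge0_fin_numE// (le_lt_trans Ud) ?ltry.
have dE := fineK dfin; split.
  by rewrite -!lee_fin dE d0 Ud.
by move=> x y Ux Uy; rewrite -lee_fin dE h.
Qed.

Lemma hcost_ge0 (beta : R) (U : set Rn) : (0 <= hcost beta U)%E.
Proof. by rewrite /hcost; case: ifP => // _; rewrite lee_fin powR_ge0. Qed.

Variables (g : 'I_n.+1 -> R -> R) (E : set Rn) (alpha : R).
(** A closed cube inside the half-open unit cube: it is a box of known volume, and Cantor parameters
    must stay below 1. *)
Let half (s : R) := 0 <= s <= 2^-1.
Hypothesis gE : forall s : 'I_n.+1 -> R, (forall i, half (s i)) -> E [tuple g i (s i) | i < n.+1].
Hypothesis g_inj : forall i s s', half s -> half s' -> g i s = g i s' -> s = s'.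
Hypothesis g_mod : forall beta, 0 <= beta -> beta < alpha ->
  exists C delta : R, [/\ 0 < C, 0 < delta & forall r, 0 < r -> r <= delta ->
    exists phi : 'I_n.+1 -> R,
     (forall i s s', half s -> half s' -> `|g i s - g i s'| <= r -> `|s - s'| <= phi i) /\
     \prod_(i < n.+1) phi i <= C * r `^ beta].

Let preim (U : set Rn) : set Rn := [set s : Rn | (forall i, half (tnth s i)) /\
  U [tuple g i (tnth s i) | i < n.+1]].

(** The box is centred at one parameter of the preimage and has half-sides [phi i], whence 2^(n+1).
    For a set of diameter 0 no positive r is at hand; injectivity then shrinks the box to a
    point. *)
Let preim_box (beta C delta : R) (U : set Rn) : 0 < C ->
  (forall r, 0 < r -> r <= delta ->
    exists phi : 'I_n.+1 -> R,
     (forall i s s', half s -> half s' -> `|g i s - g i s'| <= r -> `|s - s'| <= phi i) /\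
     \prod_(i < n.+1) phi i <= C * r `^ beta) ->
  (diamn U <= delta%:E)%E ->
  exists ab : ('I_n.+1 -> R) * ('I_n.+1 -> R), [/\ forall i, ab.1 i <= ab.2 i,
    preim U `<=` box ab.1 ab.2 &
    ((bvol ab.1 ab.2)%:E <= (2 ^+ n.+1 * C)%:E * hcost beta U)%E].
Proof.
move=> C0 Hphi Ud.
have hc0 : (0 <= (2 ^+ n.+1 * C)%:E * hcost beta U)%E.
  by rewrite mule_ge0 ?hcost_ge0// lee_fin mulr_ge0 ?exprn_ge0// ltW.
have [[s0 [s0h Us0]]|noU] := pselect (exists s, preim U s); last first.
  exists (fun=> 0, fun=> 0); split=> //=; last by rewrite bvol_degenerate.
  by move=> s Us; exfalso; apply: noU; exists s.
have [|/andP[d0 dd] dist_d] := @diamn_bounds U delta _ Ud; first by eexists; exact: Us0.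
have close s i : preim U s -> `|g i (tnth s i) - g i (tnth s0 i)| <= fine (diamn U).
  move=> [sh Us]; have := dist_d _ _ Us Us0; apply: le_trans.
  by have := coord_le_distn [tuple g i (tnth s i) | i < n.+1] [tuple g i (tnth s0 i) | i < n.+1] i; rewrite !tnth_mktuple.
have [d_gt0|d_le0] := ltP 0 (fine (diamn U)); last first.
  exists (tnth s0, tnth s0); split => //=; last by rewrite bvol_degenerate.
  move=> s Us i /=; rewrite (_ : tnth s i = tnth s0 i) ?lexx//.
  apply: (@g_inj i) => //; first by case: Us.
  by apply/eqP; rewrite -subr_eq0 -normr_le0 (le_trans (close _ i Us)).
have [phi [phiP phiC]] := Hphi _ d_gt0 dd.
have phi0 i : 0 <= phi i.
  by apply: le_trans (phiP i _ _ (s0h i) (s0h i) _); rewrite // subrr normr0 ltW.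
exists (fun i => tnth s0 i - phi i, fun i => tnth s0 i + phi i); split => /=.
- by move=> i; have := phi0 i; lra.
- move=> s Us i /=; have [sh _] := Us.
  by have := phiP i _ _ (sh i) (s0h i) (close s i Us); rewrite ler_distl => /andP[-> ->].
rewrite /hcost ifF; last by apply/asboolPn => U0; move: Us0; rewrite U0.
rewrite -EFinM lee_fin -mulrA.
have -> : bvol (fun i => tnth s0 i - phi i) (fun i => tnth s0 i + phi i) =
    2 ^+ n.+1 * \prod_(i < n.+1) phi i.
  rewrite -[in 2 ^+ _](card_ord n.+1) -prodr_const -big_split /=.
  by apply: eq_bigr => i _; lra.
by rewrite ler_wpM2l// exprn_ge0.
Qed.

(** Mass distribution principle, with Lebesgue measure on the parameters: a cover of [E] pulls back
    to boxes covering the parameter cube, of volume [v], so it costs at least v / K. Pulling back to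
    boxes avoids any measurability question about the covering sets. *)
Lemma hausdorff_dim_ge : (alpha%:E <= hausdorff_dim E)%E.
Proof.
apply: le_ereal_inf_tmp => _ [beta [beta0 HE] <-]; rewrite lee_fin leNgt.
apply/negP => /(g_mod beta0)[C [delta [C0 delta0 Hphi]]].
have : (hausdorff_content beta delta E <= hausdorff_measure beta E)%E.
  by apply: ereal_sup_ubound; exists delta.
rewrite HE leNgt => /negP; apply.
pose K := 2 ^+ n.+1 * C; have K0 : 0 < K by rewrite mulr_gt0 ?exprn_gt0.
pose v : R := 2^-1 ^+ n.+1; have v0 : 0 < v by rewrite exprn_gt0// invr_gt0.
apply: (@lt_le_trans _ _ (v / K)%:E); first by rewrite lte_fin divr_gt0.
apply: le_ereal_inf_tmp => _ [U [EU Ud] <-].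
have /choice[ab Hab] k := preim_box C0 Hphi (Ud k).
rewrite -(@lee_pmul2l _ K%:E) ?ltry ?lte_fin// -EFinM mulrC divfK ?gt_eqF//.
have vE : v%:E = leb (box (fun=> 0) (fun=> 2^-1) : set Rn).
  rewrite leb_box; last by move=> _; rewrite invr_ge0.
  by rewrite /bvol prodr_const card_ord subr0.
rewrite vE (le_trans (@lebn_le_cover _ _ _ (fun k => (ab k).1) (fun k => (ab k).2) _))//.
  split=> [k i|s sh]; first by have [] := Hab k.
  have [k _ Uk] := EU _ (gE sh).
  by exists k => //; have [_ + _] := Hab k; apply; split.
rewrite -nneseriesZl; last first.
  by move=> k _; exact: hcost_ge0.
apply: lee_nneseries => k _; first by rewrite lee_fin bvol_ge0//; have [] := Hab k.
by have [] := Hab k.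
Qed.

End hausdorff.

(** * Combining the scales *)

Section multiscale.
Context {R : realType} (n : nat).

Lemma powR_gt0E (r a : R) : 0 < r -> r `^ a = expR (a * ln r).
Proof. by move=> r0; rewrite /powR gt_eqF. Qed.

Lemma powR_gt0D (r a b : R) : 0 < r -> r `^ (a + b) = r `^ a * r `^ b.
Proof. by move=> r0; rewrite !powR_gt0E// mulrDl expRD. Qed.

Variables (eta rho : 'I_n.+1 -> nat -> R) (T : nat -> R) (alpha sigma C : R).
Hypothesis eta_gt0 : forall i k, 0 < eta i k.
Hypothesis rho_gt0 : forall i k, 0 < rho i k.
Hypothesis rho_le_eta : forall i k, rho i k <= eta i k.
Hypothesis eta_le_rho : forall i k, 4 * eta i k.+1 <= rho i k.
Hypothesis T_ge1 : forall k, 1 <= T k.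
Hypothesis T_homo : {homo T : k l / (k <= l)%N >-> k <= l}.
Hypothesis T_unbounded : forall x : R, exists k, x < T k.
Hypothesis sigma_gt0 : 0 < sigma.
Hypothesis sigma_le1 : sigma <= 1.
Hypothesis C_ge0 : 0 <= C.
Hypothesis eta_next : forall i k, eta i k.+2 <= (T k.+1)^-1.
Hypothesis eta_sigma : forall i k, eta i k.+1 <= T k.+1 `^ (- sigma).
Hypothesis one_scale : forall k r, (T k.+1)^-1 <= r -> r <= 1 ->
  \prod_(i < n.+1) Num.min (eta i k.+1 + r) (eta i k.+1 / rho i k.+1 * r) <= C * r `^ alpha.
Hypothesis one_scale_count : forall k,
  \prod_(i < n.+1) (eta i k.+1 / rho i k.+1) <= C * T k.+1 `^ (n.+1%:R - alpha).

Let M i k := cantor_count (eta i) (rho i) k.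
(** Up to the factor 4, parameter length 1 / M per length rho of an interval of generation k. It
    measures what all scales up to k cost together. *)
Definition cantor_density i k : R := 4 * (M i k)%:R^-1 / rho i k.
Local Notation b := cantor_density.
Hypothesis T_growth : forall k, \prod_(i < n.+1) b i k <= T k.+1 `^ (k.+1%:R^-1).

Let M_gt0 i k : 0 < (M i k)%:R :> R.
Proof. by rewrite ltr0n; exact: cantor_count_gt0. Qed.

Let b_gt0 i k : 0 < b i k.
Proof. by rewrite /b divr_gt0// mulr_gt0// invr_gt0. Qed.

Let invM_le i k : (M i k.+1)%:R^-1 <= b i k * eta i k.+1.
Proof.
rewrite (le_trans (cantor_count_invS _ _ _ _))//.
by rewrite /b le_eqVlt; apply/orP; left; apply/eqP; rewrite -/(M i k); ring.
Qed.

Let b_step i k : b i k.+1 <= 4 * (b i k * (eta i k.+1 / rho i k.+1)).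
Proof.
rewrite [leRHS](_ : _ = 4 * (b i k * eta i k.+1) / rho i k.+1); last by ring.
by rewrite ler_wpM2r ?invr_ge0 ?(ltW (rho_gt0 _ _))// ler_wpM2l.
Qed.

(** Two competing bounds: the first entry of the minimum comes from the modulus at generation k.+2,
    where points are eta apart; the second comes from generation k.+3, whose step is below r. *)
Let phi k (r : R) i : R :=
  12 * (b i k.+1 * Num.min (eta i k.+2 + r) (eta i k.+2 / rho i k.+2 * r)).

Let modulus_phi k r i s s' : 0 <= s -> 0 <= s' -> (T k.+2)^-1 <= r ->
  `|cantor_fun (eta i) (rho i) s - cantor_fun (eta i) (rho i) s'| <= r ->
  `|s - s'| <= phi k r i.
Proof.
move=> s0 s'0 Tr gr.
have r0 : 0 < r by apply: lt_le_trans Tr; rewrite invr_gt0 (lt_le_trans ltr01).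
have main l : `|s - s'| <= b i l * (2 * eta i l.+1 + r).
  apply: le_trans (cantor_fun_modulus (eta_gt0 i) (rho_gt0 i) (rho_le_eta i)
    (eta_le_rho i) l.+1 s0 s'0) _.
  apply: (@le_trans _ _ ((M i l.+1)%:R^-1 * (2 + r / eta i l.+1))).
    by rewrite ler_wpM2l ?invr_ge0// lerD2l ler_pM2r ?invr_gt0.
  apply: (@le_trans _ _ (b i l * eta i l.+1 * (2 + r / eta i l.+1))).
    by rewrite ler_wpM2r// addr_ge0// divr_ge0// ltW.
  rewrite le_eqVlt; apply/orP; left; apply/eqP; field.
  by rewrite gt_eqF.
rewrite /phi; have [_|_] := leP (eta i k.+2 + r) _.
  apply: (le_trans (main k.+1)); rewrite mulrCA ler_wpM2l ?(ltW (b_gt0 _ _))//.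
  by have := eta_gt0 i k.+2; lra.
apply: (le_trans (main k.+2)).
have h : 2 * eta i k.+3 + r <= 3 * r by have := eta_next i k.+1; lra.
apply: (@le_trans _ _ (b i k.+2 * (3 * r))).
  by rewrite ler_wpM2l ?(ltW (b_gt0 _ _)).
apply: (@le_trans _ _ (4 * (b i k.+1 * (eta i k.+2 / rho i k.+2)) * (3 * r))).
  by rewrite ler_wpM2r ?b_step// mulr_ge0// ltW.
by rewrite le_eqVlt; apply/orP; left; apply/eqP; ring.
Qed.

Let T_gt0 k : 0 < T k. Proof. exact: lt_le_trans (T_ge1 k). Qed.

Let min_ge0 i k (r : R) : 0 < r ->
  0 <= Num.min (eta i k + r) (eta i k / rho i k * r).
Proof.
move=> r0; have e0 := eta_gt0 i k; have h0 := rho_gt0 i k.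
by rewrite le_min; apply/andP; split; rewrite ltW// ?(addr_gt0, mulr_gt0, invr_gt0).
Qed.

Let expn_prod (x : R) : x ^+ n.+1 = \prod_(i < n.+1) x.
Proof. by rewrite prodr_const card_ord. Qed.

Let prod_b_step k : \prod_(i < n.+1) b i k.+1 <=
  4 ^+ n.+1 * ((\prod_(i < n.+1) b i k) * \prod_(i < n.+1) (eta i k.+1 / rho i k.+1)).
Proof.
rewrite expn_prod -!big_split /=.
by apply: ler_prod => i _; rewrite (ltW (b_gt0 _ _)) b_step.
Qed.

(** The cost of the coarser scales, a small power of T, has to be absorbed by r^(alpha - beta). For
    r <= T k.+2 ^ (-sigma) this factor beats the cost T k.+2 ^ (1/(k+2)), and scale k.+2 supplies
    r^alpha. For larger r it need not, and scale k.+1 is used instead. *)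
Let prod_phi k (beta r : R) : (k.+1%:R * sigma)^-1 <= alpha - beta ->
  (T k.+2)^-1 <= r -> r <= (T k.+1)^-1 ->
  alpha <= n.+1%:R -> \prod_(i < n.+1) phi k r i <= (12 ^+ n.+1 * C + 96 ^+ n.+1 * C) * r `^ beta.
Proof.
move=> kab Tr rT aln.
have r0 : 0 < r by apply: lt_le_trans Tr; rewrite invr_gt0.
have r1 : r <= 1 by rewrite (le_trans rT)// invf_le1.
have lr : ln r <= - ln (T k.+1).
  by rewrite -lnV ?posrE// ler_ln ?posrE ?invr_gt0.
have lT : 0 <= ln (T k.+1) by rewrite ln_ge0.
have k0 : (0 : R) < k.+1%:R by [].
have kb : k.+1%:R^-1 <= alpha - beta.
  apply: le_trans kab; rewrite lef_pV2 ?posrE ?mulr_gt0//.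
  by rewrite -[leRHS]mulr1 ler_pM2l.
rewrite mulrDl; have [rs|rs] := leP r (T k.+2 `^ (- sigma)).
  apply: (@le_trans _ _ (12 ^+ n.+1 * C * r `^ beta)); last first.
    by rewrite lerDl !mulr_ge0 ?exprn_ge0 ?powR_ge0.
  rewrite /phi big_split /= prodr_const card_ord -mulrA ler_pM2l ?exprn_gt0//.
  rewrite big_split /=.
  apply: (@le_trans _ _ (T k.+2 `^ (k.+2%:R^-1) * (C * r `^ alpha))).
    apply: ler_pM => //; last exact: one_scale.
      by apply: prodr_ge0 => i _; rewrite ltW.
    by apply: prodr_ge0 => i _; exact: min_ge0.
  rewrite mulrCA ler_wpM2l// !powR_gt0E// -expRD ler_expR.
  have lrs : ln r <= - sigma * ln (T k.+2).
    by rewrite -ln_powR ler_ln ?posrE ?powR_gt0.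
  have lT2 : 0 <= ln (T k.+2) by rewrite ln_ge0.
  have kk : k.+2%:R^-1 <= (k.+1%:R)^-1 :> R.
    by rewrite lef_pV2 ?posrE// ler_nat.
  have h1 : k.+1%:R^-1 <= (alpha - beta) * sigma.
    by rewrite -ler_pdivrMr// -invfM.
  have h2 : k.+2%:R^-1 * ln (T k.+2) <= (alpha - beta) * sigma * ln (T k.+2).
    by rewrite ler_wpM2r//; exact: le_trans h1.
  have h3 : (alpha - beta) * (sigma * ln (T k.+2)) <= (alpha - beta) * (- ln r).
    by rewrite ler_wpM2l; [|apply: le_trans kb; rewrite invr_ge0|lra].
  move: h2 h3; set u := _%:R^-1 * _ => h2 h3; lra.
(* Now r exceeds eta k.+2: scale k.+2 looks full and the minimum is at most 2 r. What remains is the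
   count of scale k.+1, with r <= 1 / T k.+1. The constant is 96 = 12 * 2 * 4. *)
apply: (@le_trans _ _ (96 ^+ n.+1 * C * r `^ beta)); last first.
  by rewrite lerDr !mulr_ge0 ?exprn_ge0 ?powR_ge0.
apply: (@le_trans _ _ (24 ^+ n.+1 * (r ^+ n.+1 * \prod_(i < n.+1) b i k.+1))).
  rewrite (expn_prod 24) (expn_prod r) -!big_split /=; apply: ler_prod => i _.
  rewrite /phi; apply/andP; split.
    by apply: mulr_ge0 => //; apply: mulr_ge0; [exact: ltW|exact: min_ge0].
  have h : Num.min (eta i k.+2 + r) (eta i k.+2 / rho i k.+2 * r) <= 2 * r.
    by rewrite ge_min; apply/orP; left; have := eta_sigma i k.+1; lra.
  have := ler_wpM2l (ltW (b_gt0 i k.+1)) h; lra.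
apply: (@le_trans _ _ (24 ^+ n.+1 * (r ^+ n.+1 * (4 ^+ n.+1 *
   (T k.+1 `^ (k.+1%:R^-1) * (C * T k.+1 `^ (n.+1%:R - alpha))))))).
  rewrite ler_pM2l ?exprn_gt0// ler_pM2l ?exprn_gt0//.
  apply: (le_trans (prod_b_step k)); rewrite ler_pM2l ?exprn_gt0//.
  apply: ler_pM => //; first by apply: prodr_ge0 => i _; rewrite ltW.
  by apply: prodr_ge0 => i _; rewrite divr_ge0// ltW.
have -> : (96 : R) = 24 * 4 by ring.
rewrite exprMn -!mulrA ler_pM2l ?exprn_gt0// mulrCA ler_pM2l ?exprn_gt0//.
rewrite [leLHS](_ : _ = C * (r ^+ n.+1 * T k.+1 `^ k.+1%:R^-1 * T k.+1 `^ (n.+1%:R - alpha))); last by ring.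
rewrite ler_wpM2l//.
rewrite -powR_mulrn ?(ltW r0)// !powR_gt0E// -!expRD ler_expR.
have h : (n.+1%:R - beta) * ln (T k.+1) <= (n.+1%:R - beta) * (- ln r).
  have ik : 0 <= (k.+1%:R)^-1 :> R by rewrite invr_ge0.
  have ba : beta <= alpha by rewrite -subr_ge0 (le_trans ik).
  have nb : 0 <= n.+1%:R - beta by rewrite subr_ge0 (le_trans ba).
  by rewrite ler_wpM2l// lerNr.
have h1 : k.+1%:R^-1 * ln (T k.+1) <= (alpha - beta) * ln (T k.+1).
  by rewrite ler_wpM2r.
move: h h1; set u := _%:R^-1 * _ => h h1; lra.
Qed.

Lemma multiscale_modulus (beta : R) : beta < alpha -> alpha <= n.+1%:R ->
  exists C delta : R, [/\ 0 < C, 0 < delta & forall r, 0 < r -> r <= delta ->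
    exists phi : 'I_n.+1 -> R,
     (forall i s s', 0 <= s <= 2^-1 -> 0 <= s' <= 2^-1 ->
       `|cantor_fun (eta i) (rho i) s - cantor_fun (eta i) (rho i) s'| <= r -> `|s - s'| <= phi i) /\
     \prod_(i < n.+1) phi i <= C * r `^ beta].
Proof.
move=> ba aln; pose k0 := Num.truncn ((alpha - beta) * sigma)^-1.
exists (12 ^+ n.+1 * C + 96 ^+ n.+1 * C + 1), (T k0.+1)^-1; split.
- by rewrite ltr_wpDl// addr_ge0// mulr_ge0// exprn_ge0.
- by rewrite invr_gt0.
move=> r r0 rT.
have exk : exists k, r^-1 < T k by exact: T_unbounded.
(* T K.-1 <= 1/r < T K, and [delta] makes K so large that the exponent lost to the coarser scales is
   at most (alpha - beta) * sigma. *)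
case: (ex_minnP exk) => K rK Kmin.
have k0K : (k0.+1 < K)%N.
  rewrite ltnNge; apply/negP => /T_homo TK.
  have := lt_le_trans rK TK; rewrite ltNge => /negP; apply.
  by rewrite -[leLHS]invrK lef_pV2 ?posrE ?invr_gt0.
have [k KE] : exists k, K = k.+2 by exists K.-2; case: K k0K {rK Kmin} => [|[]].
rewrite KE in rK k0K Kmin.
have rk1 : r <= (T k.+1)^-1.
  rewrite -[leLHS]invrK lef_pV2 ?posrE ?invr_gt0// leNgt.
  by apply/negP => /Kmin; rewrite ltnn.
have rk2 : (T k.+2)^-1 <= r.
  by rewrite -[leRHS]invrK lef_pV2 ?posrE ?invr_gt0// ltW.
exists (phi k r); split.
  move=> i s s' /andP[s0 _] /andP[s'0 _]; exact: modulus_phi.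
apply: (le_trans (prod_phi (beta := beta) _ rk2 rk1 aln)).
  rewrite -[leRHS]invrK lef_pV2 ?posrE ?invr_gt0 ?mulr_gt0 ?subr_gt0//.
  rewrite -ler_pdivrMr// -invfM.
  apply: ltW; apply: (lt_le_trans (truncnS_gt _)).
  by rewrite ler_nat.
by rewrite ler_wpM2r ?powR_ge0// lerDl.
Qed.

End multiscale.

(** * Exponents and lattices at one scale *)

Section exponents.
Context {R : realType} (n : nat) (alpha : R).
Local Notation d := (n.+1%:R : R).
Local Notation N := (n.+2%:R : R).

(* At scale [T] the frequency gap is about [T^a], the moduli about [T^j]; the lattice has steps
   about [T^-e] in the first coordinate and [T^-b] in the others, with tolerances [T^(-1/2)] and
   [T^-1].  The last equation says that the resulting set has dimension [alpha]. *)
Definition scale_exponents (a j e b : R) : Prop :=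
  [/\ 2^-1 < a, a < 1, 0 <= j, (0 < j -> e = 2^-1) & [/\ 0 < e, e <= 2^-1, b <= 1 &
  [/\ b = a + j, e = 2 * a - 1 - j * d, alpha - d <= 2 * e & e + 2^-1 + d * b = alpha]]].

(** The left side of the last equation is the exponent of T in the volume of a block, to be compared
    with twice the regularity. As long as e = 2a - 1 stays below 1/2 one takes j = 0; beyond, j
    brings e back to 1/2. *)
Lemma exists_scale_exponents : N / 2 < alpha -> alpha <= N ->
  exists a j e b, scale_exponents a j e b /\
   2^-1 + d * (1 - a) = 2 * (N / (2 * (N + 1)) + (N - 1) / (2 * (N + 1)) * (N - alpha)).
Proof.
move=> al1 al2.
have dE : N = d + 1 by rewrite natr1.
have d1 : 1 <= d by rewrite ler1n.
move: al1 al2 dE d1; rewrite /scale_exponents; move: d N => D NN al1 al2 dE d1.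
pose a := (alpha + 2^-1) / (NN + 1).
have aE : a * (NN + 1) = alpha + 2^-1 by rewrite divfK// gt_eqF//; lra.
have aD : a * D = alpha + 2^-1 - 2 * a by move: aE; rewrite dE; lra.
have a1 : 2^-1 < a by rewrite ltr_pdivlMr; lra.
have a2 : a < 1 by rewrite ltr_pdivrMr; lra.
have sE : 2^-1 + D * (1 - a) = 2 * (NN / (2 * (NN + 1)) + (NN - 1) / (2 * (NN + 1)) * (NN - alpha)).
  rewrite /a dE; field; apply/negP => /eqP; lra.
have [a34|a34] := leP (2 * a) (3 / 2).
  exists a, 0, (2 * a - 1), a; split=> //; split=> //; first by rewrite ltxx.
  split; [lra|lra|lra|split; rewrite ?addr0 ?mul0r ?subr0//; last by nra].
  (* This is [alpha - d <= 2 * e] multiplied by N + 1. *)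
  have h : 0 <= (D - 2) * (D + 2 - alpha) + 2.
    have [D2|D2] := leP 2 D; first by nra.
    by nra.
  have h2 : 0 <= (4 * a - 2 - alpha + D) * (NN + 1) by rewrite dE; lra.
  by move: h2; rewrite pmulr_lge0; lra.
exists a, ((2 * a - 3 / 2) / D), 2^-1, (a + (2 * a - 3 / 2) / D); split=> //.
have jE : (2 * a - 3 / 2) / D * D = 2 * a - 3 / 2 by rewrite divfK// gt_eqF//; lra.
have j0 : 0 < (2 * a - 3 / 2) / D by rewrite divr_gt0; lra.
move: jE j0; set j := _ / D => jE j0.
have bE : D * (a + j) = alpha - 1 by lra.
split=> //; first by lra.
split=> //; first by rewrite -(ler_pM2l (_ : 0 < D)) ?bE; lra.
by split; lra.
Qed.

Variables (a j e b : R).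
Hypothesis expo : scale_exponents a j e b.
Hypothesis alpha_ge1 : 1 <= alpha.
Hypothesis alpha_le : alpha <= N.

(** The range of r is cut at T^(-e), T^(-1/2) and T^(-b), where a lattice step or a tolerance is
    crossed, and in each piece the better entry of the minimum is used in every coordinate. The
    inequality is linear in ln r on each piece, so only the cuts matter: at T^(-1/2) it is
    [alpha - d <= 2 * e], and at 1/T it is an equality, namely the dimension equation; 1 <= alpha
    makes 1/T the worst point of the last piece. *)
Lemma one_scale_bound (C T : R) (eta rho : 'I_n.+2 -> R) :
  1 <= C -> 1 <= T ->
  (forall i, 0 < eta i) -> (forall i, 0 < rho i) ->
  eta ord0 <= C * T `^ (- e) -> eta ord0 / rho ord0 <= C * T `^ (2^-1 - e) ->
  (forall i, eta (lift ord0 i) <= C * T `^ (- b)) ->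
  (forall i, eta (lift ord0 i) / rho (lift ord0 i) <= C * T `^ (1 - b)) ->
  (forall r, T^-1 <= r -> r <= 1 ->
    \prod_(i < n.+2) Num.min (eta i + r) (eta i / rho i * r) <=
      (2 * C) ^+ n.+2 * r `^ alpha) /\
  \prod_(i < n.+2) (eta i / rho i) <= (2 * C) ^+ n.+2 * T `^ (N - alpha).
Proof.
have [a_gt a_lt j_ge je [e_gt e_le b_le [bE eE ealpha balance]]] := expo.
have b_ge : 2^-1 <= b by rewrite bE; lra.
have dE : N = d + 1 by rewrite natr1.
have d1 : 1 <= d by rewrite ler1n.
move=> C1 T1 eta0 rho0 h1 h2 h3 h4.
have T0 : 0 < T by lra.
have L0 : 0 <= ln T by rewrite ln_ge0.
have C0 : 0 <= C by lra.
have prodC (x y u : R) : 0 <= x -> 0 <= y ->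
    forall F : 'I_n.+2 -> R, (forall i, 0 <= F i) -> F ord0 <= 2 * C * x ->
    (forall i, F (lift ord0 i) <= 2 * C * y) -> x * y ^+ n.+1 <= u ->
    \prod_(i < n.+2) F i <= (2 * C) ^+ n.+2 * u.
  move=> x0 y0 F F0 Fx Fy xyu; rewrite big_ord_recl.
  apply: (@le_trans _ _ ((2 * C * x) * (2 * C * y) ^+ n.+1)).
    rewrite ler_pM ?prodr_ge0// -[n.+1 in leRHS](card_ord n.+1) -prodr_const.
    by apply: ler_prod => i _; rewrite F0 Fy.
  rewrite exprMn mulrACA -exprS ler_wpM2l// exprn_ge0//; lra.
split; last first.
  apply: (prodC (T `^ (2^-1 - e)) (T `^ (1 - b))); rewrite ?powR_ge0//.
  - by move=> i; rewrite ltW// divr_gt0.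
  - by rewrite (le_trans h2)// ler_wpM2r ?powR_ge0//; lra.
  - by move=> i; rewrite (le_trans (h4 i))// ler_wpM2r ?powR_ge0//; lra.
  rewrite -powR_mulrn ?powR_ge0// -powRrM !powR_gt0E// -expRD -mulrDl.
  have -> : 2^-1 - e + (1 - b) * d = N - alpha by rewrite dE; lra.
  by [].
move=> r rT r1.
have r0 : 0 < r by rewrite (lt_le_trans _ rT)// invr_gt0.
have l0 : ln r <= 0 by exact: ln_le0.
have lL : - ln T <= ln r by rewrite -lnV ?posrE// ler_ln ?posrE ?invr_gt0.
have minE i x : eta i + r <= x \/ eta i / rho i * r <= x ->
    Num.min (eta i + r) (eta i / rho i * r) <= x.
  by rewrite ge_min => -[->|->]; rewrite ?orbT.
have min0 i : 0 <= Num.min (eta i + r) (eta i / rho i * r).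
  by rewrite le_min; apply/andP; split; rewrite ltW// ?(addr_gt0, mulr_gt0, invr_gt0).
have CT (x : R) : x <= r -> C * x + r <= 2 * C * r.
  move=> xr; have := ler_wpM2l C0 xr; have : 0 <= (C - 1) * r by apply: mulr_ge0; lra.
  lra.
have CT' (x : R) : r <= x -> C * x + r <= 2 * C * x.
  move=> xr; have : 0 <= (C - 1) * x by apply: mulr_ge0; lra.
  lra.
have Tl (x : R) : T `^ (- x) <= r -> - (x * ln T) <= ln r.
  by move=> h; rewrite -mulNr -ln_powR ler_ln ?posrE ?powR_gt0.
have Tl' (x : R) : r <= T `^ (- x) -> ln r <= - (x * ln T).
  by move=> h; rewrite -mulNr -ln_powR ler_ln ?posrE ?powR_gt0.
have TT (x y : R) : x <= y -> T `^ (- y) <= T `^ (- x).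
  by move=> xy; rewrite ler_powR// lerN2.
have [c1|c1] := leP (T `^ (- e)) r.
  apply: (prodC r r); rewrite ?(ltW r0)//.
  - by apply: minE; left; apply: le_trans (CT _ c1); rewrite lerD2r.
  - move=> i; apply: minE; left; have h := le_trans (TT e b ltac:(lra)) c1.
    by apply: le_trans (CT _ h); rewrite lerD2r.
  rewrite -exprS -powR_mulrn ?(ltW r0)// !powR_gt0E// ler_expR.
  by rewrite ler_wnM2r.
have [c2|c2] := leP (T `^ (- 2^-1)) r.
  apply: (prodC (T `^ (- e)) r); rewrite ?(ltW r0) ?powR_ge0//.
  - by apply: minE; left; apply: le_trans (CT' _ (ltW c1)); rewrite lerD2r.
  - move=> i; apply: minE; left; have h := le_trans (TT 2^-1 b ltac:(lra)) c2.
    by apply: le_trans (CT _ h); rewrite lerD2r.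
  rewrite -powR_mulrn ?(ltW r0)// !powR_gt0E// -expRD ler_expR.
  have := Tl _ c2 => {}c2; nra.
have [c3|c3] := leP (T `^ (- b)) r.
  apply: (prodC (T `^ (2^-1 - e) * r) r); rewrite ?(ltW r0) ?mulr_ge0 ?powR_ge0//; rewrite ?(ltW r0)//.
  - apply: minE; right; apply: (@le_trans _ _ (C * T `^ (2^-1 - e) * r)).
      by rewrite ler_wpM2r// ltW.
    have : 0 <= C * T `^ (2^-1 - e) * r by rewrite !mulr_ge0 ?powR_ge0// ltW.
    lra.
  - move=> i; apply: minE; left.
    by apply: le_trans (CT _ c3); rewrite lerD2r.
  rewrite -powR_mulrn ?(ltW r0)// !powR_gt0E// -mulrA -{1}[r]lnK ?posrE// -!expRD ler_expR.
  have := Tl' _ (ltW c2) => {}c2; nra.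
apply: (prodC (T `^ (2^-1 - e) * r) (T `^ (- b))); rewrite ?mulr_ge0 ?powR_ge0//; rewrite ?(ltW r0)//.
- apply: minE; right; apply: (@le_trans _ _ (C * T `^ (2^-1 - e) * r)).
    by rewrite ler_wpM2r// ltW.
  have : 0 <= C * T `^ (2^-1 - e) * r by rewrite !mulr_ge0 ?powR_ge0// ltW.
  lra.
- move=> i; apply: minE; left.
  by apply: le_trans (CT' _ (ltW c3)); rewrite lerD2r.
rewrite -powR_mulrn ?powR_ge0// -powRrM !powR_gt0E// -mulrA -{1}[r]lnK ?posrE// -!expRD ler_expR.
have h : 0 <= (alpha - 1) * (ln T + ln r).
  by apply: mulr_ge0; [rewrite subr_ge0|rewrite addrC -[ln T]opprK subr_ge0].
have bd : b * d * ln T = (alpha - e - 2^-1) * ln T by rewrite -balance; ring.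
clear - h bd; rewrite mulNr.
lra.
Qed.

End exponents.

(** * Coprime moduli and simultaneous congruences *)

Section chinese_remainders.

Lemma chinese_family (J m : nat -> nat) (d : nat) :
  (forall i k, (i < k < d)%N -> coprime (J i) (J k)) ->
  exists p, forall i, (i < d)%N -> p = m i %[mod J i].
Proof.
elim: d => [|d IH] cop; first by exists 0%N.
have [|p pP] := IH; first by move=> i k /andP[ik kd]; rewrite cop// ik ltnS ltnW.
have cpd : coprime (\prod_(i < d) J i) (J d).
  elim/big_rec: _ => [|i x _ h]; first by rewrite coprime1n.
  by rewrite coprimeMl h cop ?ltn_ord/=.
exists (chinese (\prod_(i < d) J i) (J d) p (m d)) => i.
rewrite ltnS leq_eqVlt => /predU1P[->|id]; first by rewrite chinese_modr.
rewrite -pP// -(@modn_dvdm (\prod_(i < d) J i)); last first.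
  by rewrite (bigD1 (Ordinal id))//= dvdn_mulr.
by rewrite chinese_modl// modn_dvdm// (bigD1 (Ordinal id))//= dvdn_mulr.
Qed.

(** A common divisor g is coprime to M, since it divides 1 + i M, and it divides (k - i) M; hence it
    divides k - i, which divides d! and so M. *)
Lemma coprime_arithmetic_progression (q d i k : nat) : (i < k <= d)%N ->
  coprime (1 + i * (d`! * q)) (1 + k * (d`! * q)).
Proof.
move=> /andP[ik kd]; set M := (d`! * q)%N.
rewrite /coprime -dvdn1; set g := gcdn _ _.
have g1 : (g %| 1 + i * M)%N by exact: dvdn_gcdl.
have g2 : (g %| 1 + k * M)%N by exact: dvdn_gcdr.
have gki : (g %| (k - i) * M)%N.
  by move: (dvdn_sub g2 g1); rewrite subnDl -mulnBl.
have gM : coprime g M.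
  rewrite /coprime -dvdn1; have h : (gcdn g M %| 1 + i * M)%N by rewrite (dvdn_trans (dvdn_gcdl _ _)).
  by move: h; rewrite addnC dvdn_addr// dvdn_mull// dvdn_gcdr.
rewrite Gauss_dvdl// in gki.
have : (k - i %| M)%N by rewrite dvdn_mulr// dvdn_fact// subn_gt0 ik (leq_trans (leq_subr _ _)).
move=> kM; have : (g %| gcdn g M)%N by rewrite dvdn_gcd dvdnn (dvdn_trans gki).
by rewrite (eqP gM).
Qed.

End chinese_remainders.

(** * Lattices, tolerances and moduli at one scale *)

Section level.
Context {R : realType} (n : nat) (alpha a j e b : R).
Local Notation d := (n.+1).
Hypothesis expo : scale_exponents n alpha a j e b.

(** Each of the n + 2 coordinates will contribute a phase error of at most 10 [tiny] turns, that is
    1/20 of a turn in all, and 2 pi / 20 < 1/2. *)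
Definition tiny : R := (200 * n.+2%:R)^-1.
(** When the moduli are not all 1, this makes them at most tiny / 2 * T^j; the factor 1/2 cancels
    the 2 in the step of the first lattice, which then is within the tolerance. *)
Definition tiny2 : R := tiny / (4 * d%:R * d`!%:R).
Local Notation c := tiny.
Local Notation c2 := tiny2.

Variable T : R.

Definition freq_gap : nat := (Num.truncn (T `^ a)).+1.
(** The factor d! in the difference of the progression makes the moduli pairwise coprime. For j = 0
    the floor vanishes, and no congruence is imposed. *)
Definition crt_modulus (i : nat) : nat :=
  (1 + i.+1 * (d`! * Num.truncn (c2 * T `^ j)))%N.
Definition crt_modulus_prod : nat := (\prod_(i < d) crt_modulus i)%N.
Definition freq_count : nat := Num.truncn (T / freq_gap%:R).

Definition level_eta (i : 'I_n.+2) : R :=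
  if unlift ord0 i is Some i' then (freq_gap%:R * (crt_modulus i')%:R)^-1
  else 2 * crt_modulus_prod%:R * T / freq_gap%:R ^+ 2.
(** The tolerance that resonance allows, capped at one lattice cell because the Cantor construction
    requires rho <= eta. *)
Definition level_rho (i : 'I_n.+2) : R :=
  Num.min (c / (if i == ord0 then Num.sqrt T else T)) (level_eta i).

Hypothesis T1 : 1 <= T.
Let T0 : 0 < T. Proof. exact: lt_le_trans T1. Qed.

Let fact_gt0' : (0:R) < d`!%:R. Proof. by rewrite ltr0n fact_gt0. Qed.

Lemma tiny_gt0 : 0 < c. Proof. by rewrite invr_gt0 mulr_gt0. Qed.

Lemma tiny_le : c <= 100^-1.
Proof.
rewrite lef_pV2 ?posrE ?mulr_gt0//; have : 1 <= n.+2%:R :> R by rewrite ler1n.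
by lra.
Qed.

Lemma tiny2_gt0 : 0 < c2.
Proof. by rewrite divr_gt0 ?tiny_gt0 ?mulr_gt0. Qed.

Lemma freq_gap_bounds : T `^ a <= freq_gap%:R /\ freq_gap%:R <= 2 * T `^ a.
Proof.
have [_ _ _ _ [_ _ _ _]] := expo.
have Ta1 : 1 <= T `^ a.
  have [a_gt _ _ _ _] := expo.
  by rewrite -[leLHS](powRr0 T) ler_powR// (le_trans _ (ltW a_gt)).
split; first exact: ltW (truncnS_gt _).
rewrite /freq_gap -natr1; have : (Num.truncn (T `^ a))%:R <= T `^ a by rewrite truncn_le powR_ge0.
lra.
Qed.

Lemma freq_gap_gt0 : (0:R) < freq_gap%:R. Proof. by rewrite ltr0n. Qed.

Let q := Num.truncn (c2 * T `^ j).

Lemma crt_modulus_ge i : c2 * T `^ j <= (crt_modulus i)%:R.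
Proof.
apply: ltW; apply: (lt_le_trans (truncnS_gt _)); rewrite ler_nat -/q /crt_modulus add1n ltnS -/q.
by rewrite mulnA leq_pmull// muln_gt0 fact_gt0.
Qed.

Lemma crt_modulus_le i : (i < d)%N -> (0 < q)%N -> (crt_modulus i)%:R <= c / 2 * T `^ j.
Proof.
move=> id q0; have h : (crt_modulus i <= 2 * d * d`! * q)%N.
  rewrite /crt_modulus -/q -(mulnA (2 * d)%N); set X := (d`! * q)%N.
  have X0 : (0 < X)%N by rewrite muln_gt0 fact_gt0.
  rewrite -mulnA mul2n -addnn; apply: leq_add; first by rewrite muln_gt0.
  by rewrite leq_mul2r id orbT.
rewrite (@le_trans _ _ (2 * d * d`! * q)%:R) ?ler_nat//.
rewrite natrM; have : q%:R <= c2 * T `^ j by rewrite truncn_le mulr_ge0 ?powR_ge0// ltW// tiny2_gt0.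
rewrite -(ler_pM2l (_ : 0 < (2 * d * d`!)%:R)); last by rewrite ltr0n !muln_gt0 fact_gt0.
move=> /le_trans; apply; rewrite le_eqVlt; apply/orP; left; apply/eqP.
have gen (D F x : R) : 0 < D -> 0 < F -> 2 * D * F * (c / (4 * D * F) * x) = c / 2 * x.
  by move=> D0 F0; field; rewrite !gt_eqF.
by rewrite /c2 2!natrM gen.
Qed.

Lemma crt_modulus_le_powR i : (i < d)%N -> (crt_modulus i)%:R <= T `^ j.
Proof.
move=> id; have [_ _ j0 _ _] := expo.
have [q0|q0] := posnP q.
  rewrite /crt_modulus -/q q0 !muln0 addn0.
  by rewrite -[leLHS](powRr0 T) ler_powR.
apply: (le_trans (crt_modulus_le id q0)).
rewrite -[leRHS]mul1r ler_wpM2r ?powR_ge0//.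
by have := tiny_le; lra.
Qed.

Lemma crt_modulus_prod_le : crt_modulus_prod%:R <= T `^ (j * d%:R).
Proof.
rewrite /crt_modulus_prod natr_prod powRrM powR_mulrn ?powR_ge0//.
rewrite -[in leRHS](card_ord d) -prodr_const; apply: ler_prod => i _.
by rewrite ler0n crt_modulus_le_powR.
Qed.

Lemma crt_modulus_prod_gt0 : (0 < crt_modulus_prod)%N.
Proof. by rewrite /crt_modulus_prod prodn_gt0. Qed.

(* If [q > 0], then [j > 0], hence [e = 1/2]; if [q = 0], all the moduli are [1]. *)
Lemma crt_modulus_prod_small : (0 < q)%N ->
  2 * crt_modulus_prod%:R * T / freq_gap%:R ^+ 2 <= c / Num.sqrt T.
Proof.
move=> q0; have [a_gt _ j0 je [_ _ _ [_ eE _ _]]] := expo.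
have e2 : e = 2^-1.
  apply: je; rewrite lt_neqAle j0 andbT; apply/negP => /eqP j00.
  move: q0; rewrite /q -j00 powRr0 mulr1 truncn_gt0 leNgt => /negP; apply.
  rewrite /c2 ltr_pdivrMr ?mulr_gt0// mul1r.
  have h1 : 1 <= d%:R * d`!%:R :> R by rewrite -natrM ler1n muln_gt0 fact_gt0.
  by have := tiny_le; lra.
have Kle : crt_modulus_prod%:R <= c / 2 * T `^ (j * d%:R).
  rewrite /crt_modulus_prod natr_prod powRrM powR_mulrn ?powR_ge0//.
  apply: (@le_trans _ _ (\prod_(i < d) (c / 2 * T `^ j))).
    by apply: ler_prod => i _; rewrite ler0n crt_modulus_le.
  rewrite prodr_const card_ord exprMn ler_wpM2r ?exprn_ge0 ?powR_ge0//.
  rewrite exprS -[leRHS]mulr1 ler_wpM2l//; first by rewrite divr_ge0// ltW ?tiny_gt0.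
  by rewrite exprn_ile1//; have := tiny_gt0; have := tiny_le; lra.
have [ha _] := freq_gap_bounds.
have Ta0 : 0 < T `^ a by rewrite powR_gt0.
apply: (@le_trans _ _ (2 * (c / 2 * T `^ (j * d%:R)) * T / (T `^ a) ^+ 2)).
  rewrite ler_pM ?mulr_ge0 ?invr_ge0 ?exprn_ge0 ?(ltW T0)//.
    by rewrite ler_wpM2r ?(ltW T0)// ler_wpM2l.
  by rewrite lef_pV2 ?posrE ?exprn_gt0 ?freq_gap_gt0// lerXn2r ?nnegrE ?(ltW Ta0) ?(ltW freq_gap_gt0).
rewrite le_eqVlt; apply/orP; left; apply/eqP.
rewrite -powR12_sqrt ?(ltW T0)// -powRN.
have -> : 2 * (c / 2 * T `^ (j * d%:R)) * T / T `^ a ^+ 2 =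
  c * (T `^ (j * d%:R) * T `^ 1 * T `^ (- (a * 2%:R))).
  rewrite powRr1 ?(ltW T0)// powRN [T `^ (a * 2%:R)]powRrM powR_mulrn ?powR_ge0//.
  by field; rewrite gt_eqF.
congr (_ * _); rewrite !powR_gt0E// -!expRD; congr expR; rewrite -!mulrDl; congr (_ * _).
lra.
Qed.

Lemma level_eta0 : level_eta ord0 = 2 * crt_modulus_prod%:R * T / freq_gap%:R ^+ 2.
Proof. by rewrite /level_eta unlift_none. Qed.

Lemma level_etaS i : level_eta (lift ord0 i) = (freq_gap%:R * (crt_modulus i)%:R)^-1.
Proof. by rewrite /level_eta liftK. Qed.

Lemma level_eta_gt0 i : 0 < level_eta i.
Proof.
have D0 := freq_gap_gt0; rewrite /level_eta; case: (unlift ord0 i) => [i'|].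
  by rewrite invr_gt0 mulr_gt0// ltr0n.
by rewrite divr_gt0 ?exprn_gt0// !mulr_gt0// ltr0n crt_modulus_prod_gt0.
Qed.

Lemma level_rho_gt0 i : 0 < level_rho i.
Proof.
rewrite /level_rho lt_min level_eta_gt0 andbT divr_gt0 ?tiny_gt0//.
by case: ifP => // _; rewrite sqrtr_gt0.
Qed.

Lemma level_rho_le i : level_rho i <= level_eta i.
Proof. by rewrite /level_rho ge_min lexx orbT. Qed.

Lemma level_rho_le_tiny i :
  level_rho i <= c / (if i == ord0 then Num.sqrt T else T).
Proof. by rewrite /level_rho ge_min lexx. Qed.

Definition level_const : R := 2 / (c * c2).

Lemma tiny2_le1 : c2 <= 1.
Proof.
rewrite /c2 ler_pdivrMr ?mulr_gt0// mul1r.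
have h1 : 1 <= d%:R * d`!%:R :> R by rewrite -natrM ler1n muln_gt0 fact_gt0.
by have := tiny_le; lra.
Qed.

Lemma level_const_ge (x : R) : x <= 2 / c \/ x <= c2^-1 -> x <= level_const.
Proof.
have c0 := tiny_gt0; have c20 := tiny2_gt0; have c1 := tiny_le; have c21 := tiny2_le1.
rewrite /level_const; move: c c2 c0 c20 c1 c21 => u v c0 c20 c1 c21.
rewrite invfM mulrA => -[] /le_trans; apply.
  by rewrite ler_peMr ?divr_ge0 ?(ltW c0)// invf_ge1.
rewrite ler_peMl ?invr_ge0 ?(ltW c20)// ler_pdivlMr//; lra.
Qed.

Lemma level_const_ge1 : 1 <= level_const.
Proof. by apply: level_const_ge; right; rewrite invf_ge1 ?tiny2_gt0 ?tiny2_le1. Qed.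

Lemma level_bounds :
  [/\ level_eta ord0 <= level_const * T `^ (- e),
      level_eta ord0 / level_rho ord0 <= level_const * T `^ (2^-1 - e),
      (forall i, level_eta (lift ord0 i) <= level_const * T `^ (- b)) &
      (forall i, level_eta (lift ord0 i) / level_rho (lift ord0 i) <= level_const * T `^ (1 - b))].
Proof.
have [a_gt _ j0 _ [_ e_le b_le [bE eE _ _]]] := expo.
have c0 := tiny_gt0; have c20 := tiny2_gt0; have L1 := level_const_ge1.
have Ta0 : 0 < T `^ a by rewrite powR_gt0.
have [ha _] := freq_gap_bounds.
have D0 := freq_gap_gt0.
have ratio (x y z : R) : 0 < x -> 0 < y -> 1 <= z -> x / y <= z -> x / Num.min y x <= z.
  by move=> x0 y0 z1 xyz; rewrite minElt; case: ifP => // _; rewrite divff ?gt_eqF.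
have powT_ge1 (x : R) : 0 <= x -> 1 <= level_const * T `^ x.
  move=> x0; rewrite -[leLHS]mul1r ler_pM//.
  by rewrite -[leLHS](powRr0 T) ler_powR.
have eta0_le : level_eta ord0 <= 2 * T `^ (- e).
  rewrite level_eta0.
  apply: (@le_trans _ _ (2 * T `^ (j * d%:R) * T / (T `^ a) ^+ 2)).
    rewrite ler_pM ?mulr_ge0 ?invr_ge0 ?exprn_ge0 ?(ltW T0)//.
      by rewrite ler_wpM2r ?(ltW T0)// ler_wpM2l// crt_modulus_prod_le.
    by rewrite lef_pV2 ?posrE ?exprn_gt0// lerXn2r ?nnegrE ?(ltW Ta0) ?(ltW D0).
  rewrite -!mulrA ler_wpM2l// -powR_mulrn ?(ltW Ta0)// -powRrM -powRN -{2}[T]powRr1 ?(ltW T0)//.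
  rewrite !powR_gt0E// -!expRD ler_expR -!mulrDl ler_wpM2r ?ln_ge0//; lra.
have etaS_le i : level_eta (lift ord0 i) <= c2^-1 * T `^ (- b).
  rewrite level_etaS bE -[T `^ _](invrK) -invfM lef_pV2 ?posrE ?mulr_gt0 ?invr_gt0 ?powR_gt0 ?ltr0n//.
  rewrite powRN invrK powR_gt0D// mulrCA ler_pM ?powR_ge0//.
    by rewrite mulr_ge0 ?powR_ge0// ltW.
  exact: crt_modulus_ge.
split.
- apply: (le_trans eta0_le); rewrite ler_wpM2r ?powR_ge0//.
  by apply: level_const_ge; left; rewrite ler_pdivlMr//; have := tiny_le; lra.
- apply: ratio; rewrite ?level_eta_gt0 ?divr_gt0 ?eqxx ?sqrtr_gt0//.
    by apply: powT_ge1; lra.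
  rewrite invf_div mulrA mulrAC -powR12_sqrt ?(ltW T0)//.
  apply: (@le_trans _ _ (2 * T `^ (- e) / c * T `^ 2^-1)).
    by rewrite ler_wpM2r ?powR_ge0// ler_wpM2r ?invr_ge0// ltW.
  rewrite powR_gt0D// [leLHS](_ : _ = 2 / c * (T `^ 2^-1 * T `^ (- e))).
    rewrite ler_wpM2r ?mulr_ge0 ?powR_ge0//.
    by apply: level_const_ge; left.
  by field; rewrite gt_eqF.
- move=> i; apply: (le_trans (etaS_le i)); rewrite ler_wpM2r ?powR_ge0//.
  by apply: level_const_ge; right.
- move=> i; apply: ratio; rewrite ?level_eta_gt0 ?divr_gt0//=.
    by apply: powT_ge1; lra.
  rewrite invf_div mulrA mulrAC.
  apply: (@le_trans _ _ (c2^-1 * T `^ (- b) / c * T)).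
    by rewrite ler_wpM2r ?(ltW T0)// ler_wpM2r ?invr_ge0 ?(ltW c0).
  rewrite powR_gt0D// powRr1 ?(ltW T0)//.
  rewrite [leLHS](_ : _ = 1 / (c * c2) * (T * T `^ (- b))).
    rewrite ler_wpM2r ?mulr_ge0 ?powR_ge0 ?(ltW T0)//.
    by rewrite /level_const ler_wpM2r ?invr_ge0 ?mulr_ge0 ?(ltW c0) ?(ltW c20)// ler1n.
  by field; rewrite !gt_eqF.
Qed.

End level.

(** * Resonance *)

Section cosine.
Context {R : realType}.

Lemma cos_ge_1Bnorm (x : R) : 1 - `|x| <= cos x.
Proof.
wlog x0 : x / 0 <= x.
  move=> H; have [/H//|/ltW x0] := leP 0 x.
  by rewrite -cosN -normrN H// oppr_ge0.
rewrite ger0_norm//; move: x0; rewrite le_eqVlt => /predU1P[<-|x0].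
  by rewrite cos0 subr0.
have [|y _] := @MVT R cos (fun y => - sin y) 0 x x0.

  by apply: continuous_subspaceT => y; exact: continuous_cos.
rewrite cos0 subr0 mulNr => E.
have : sin y * x <= x by rewrite ler_piMl ?sin_le1 ?(ltW x0).
by lra.
Qed.

Lemma cos_add_2pi (x : R) (z : int) : cos (x + 2 * pi * z%:~R) = cos x.
Proof.
have nat_case (y : R) k : cos (y + 2 * pi * k%:R) = cos y.
  elim: k y => [|k IH] y; first by rewrite mulr0 addr0.
  have -> : y + 2 * pi * k.+1%:R = (y + 2 * pi * k%:R) + pi *+ 2.
    by rewrite -natr1 mulr2n; ring.
  by rewrite cosD cos2pi sin2pi mulr1 mulr0 subr0.
case: z => k; first exact: nat_case.
by rewrite NegzE mulrNz mulrN -[in RHS](subrK (2 * pi * k.+1%:R) x) nat_case.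
Qed.

Lemma pi_lt4 : pi < 4 :> R.
Proof. by have /andP[_] := @pihalf_02 R; lra. Qed.

End cosine.

(** * The frequency set of one block *)

Section frequency_sets.
Context {R : realType} (n : nat) (a j : R) (T : R).
Local Notation c := (@tiny R n).
Local Notation D := ((freq_gap a T)%:R : R).

(* For [t = 2p/D^2] and [m = p + zJ], where [J] is the [i]-th modulus, the lattice point
   [m/(DJ)] is [z/D + t * freq_shift i]. *)
Definition freq_shift (i : 'I_n.+1) : R := D / (2 * (crt_modulus n j T i)%:R).

Definition freq_itv (i : 'I_n.+1) (l : nat) : set R :=
  `[D * l%:R + freq_shift i, D * l%:R + freq_shift i + c]%classic.

Definition freq_set (i : 'I_n.+2) : set R :=
  if unlift ord0 i is Some i' then
    \big[setU/set0]_(l < freq_count a T) freq_itv i' l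
  else `[T, T + c * Num.sqrt T]%classic.

Lemma freq_set0 : freq_set ord0 = `[T, T + c * Num.sqrt T]%classic.
Proof. by rewrite /freq_set unlift_none. Qed.

Lemma freq_setS i : freq_set (lift ord0 i) =
  \big[setU/set0]_(l < freq_count a T) freq_itv i l.
Proof. by rewrite /freq_set liftK. Qed.

Lemma freq_setSP i x : freq_set (lift ord0 i) x ->
  exists l : nat, (l < freq_count a T)%N /\ 0 <= x - (D * l%:R + freq_shift i) <= c.
Proof.
rewrite freq_setS -(bigcup_mkord _ (freq_itv i)) => -[l /= lL]; rewrite /freq_itv /= in_itv/= => /andP[h1 h2].
by exists l; split => //; rewrite subr_ge0 lerBlDl h1.
Qed.

Lemma measurable_freq_set i : measurable (freq_set i).
Proof.
rewrite /freq_set; case: (unlift ord0 i) => [i'|]; last exact: measurable_itv.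
by apply: bigsetU_measurable => l _; exact: measurable_itv.
Qed.

Lemma lebesgue_freq_set0 : lebesgue_measure (freq_set ord0) = (c * Num.sqrt T)%:E.
Proof.
rewrite freq_set0 lebesgue_itvcc; first by rewrite addrC addKr.
by rewrite lerDl mulr_ge0 ?sqrtr_ge0// ltW// tiny_gt0.
Qed.

Lemma lebesgue_freq_setS i : lebesgue_measure (freq_set (lift ord0 i)) =
  ((freq_count a T)%:R * c)%:E.
Proof.
rewrite freq_setS measure_bigsetU_ord//.
  rewrite (eq_bigr (fun=> c%:E)); last first.
    move=> l _; rewrite /= /freq_itv lebesgue_itvcc; first by rewrite addrC addKr.
    by rewrite lerDl ltW// tiny_gt0.
  by rewrite sumEFin sumr_const card_ord mulr_natl.
  by move=> l; exact: measurable_itv.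
apply/trivIsetP => k l _ _ kl; apply/seteqP; split => // x.
have D1 : 1 <= D by rewrite ler1n.
have cl := @tiny_le R n.
wlog lt_kl : k l kl / (k < l)%N => [H [xk xl]|].
  move: (kl); rewrite neq_ltn => /orP[]/H{}H; apply: H => //; by rewrite eq_sym.
rewrite /freq_itv /= !in_itv/= => -[/andP[h1 h2] /andP[h3 h4]].
have : k%:R + 1 <= l%:R :> R by rewrite natr1 ler_nat.
rewrite -(ler_pM2l (_ : 0 < D)); last by lra.
by lra.
Qed.

Definition freq_volume : R := c * Num.sqrt T * ((freq_count a T)%:R * c) ^+ n.+1.

Lemma leb_freq : leb (tprod freq_set) = freq_volume%:E.
Proof.
rewrite leb_tprod; last exact: measurable_freq_set.
rewrite big_ord_recl lebesgue_freq_set0.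
rewrite (eq_bigr (fun=> ((freq_count a T)%:R * c)%:E)); last first.
  by move=> i _; rewrite lebesgue_freq_setS.
by rewrite prodEFin prodr_const card_ord -EFinM.
Qed.

End frequency_sets.

Section phase_algebra.
Context {R : realType}.

(** With u = xi - T the difference is u (x - t T) - t u^2 / 2. Here u is at most c sqrt T, against c
    / sqrt T for x - t T and 3 / T for t: this dictates both the width sqrt T and the tolerance 1 /
    sqrt T. *)
Lemma phase_first (T t x xi c : R) : 0 < T -> 0 < c -> c <= 100^-1 ->
  0 <= t -> t * T <= 3 -> `|x - t * T| <= c / Num.sqrt T ->
  T <= xi <= T + c * Num.sqrt T ->
  `|x * xi - t * xi ^+ 2 / 2 - (x * T - t * T ^+ 2 / 2)| <= 10 * c.
Proof.
move=> T0 c0 c1 t0 tT xT /andP[h1 h2].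
have s0 : 0 < Num.sqrt T by rewrite sqrtr_gt0.
have sT : Num.sqrt T ^+ 2 = T by rewrite sqr_sqrtr// ltW.
move: s0 sT xT h2; move: (Num.sqrt T) => s s0 sT xT h2.
pose u := xi - T; have u0 : 0 <= u by rewrite subr_ge0.
have u1 : u <= c * s by rewrite /u; lra.
have -> : x * xi - t * xi ^+ 2 / 2 - (x * T - t * T ^+ 2 / 2) = u * (x - t * T) - t * u ^+ 2 / 2.
  by rewrite /u; field.
apply: (le_trans (ler_normB _ _)).
have e1 : `|u * (x - t * T)| <= c.
  rewrite normrM (ger0_norm u0); apply: (@le_trans _ _ (c * s * (c / s))).
    by apply: ler_pM.
  rewrite [leLHS](_ : _ = c * c); last by field; rewrite gt_eqF.
  by nra.
have e2 : `|t * u ^+ 2 / 2| <= c.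
  rewrite ger0_norm ?mulr_ge0 ?sqr_ge0//.
  have : u ^+ 2 <= c ^+ 2 * T by rewrite -sT -exprMn lerXn2r// nnegrE mulr_ge0// ltW.
  move=> /(ler_wpM2l t0); have : c ^+ 2 * (t * T) <= c ^+ 2 * 3 by rewrite ler_wpM2l ?sqr_ge0.
  by nra.
by lra.
Qed.

(** Write xi = D l + th + u. Then x D l yields z l and t th D l; the latter cancels the cross term
    of t xi^2 / 2, which is the purpose of the shift [th], and t (D l)^2 / 2 = p l^2 is an integer.
    All the remaining terms carry a factor [eps] or [u]. *)
Lemma phase_other (T t x xi c D th eps : R) (z : int) (p l : nat) :
  1 <= T -> 0 < D -> 0 < c -> c <= 100^-1 ->
  t = 2 * p%:R / D ^+ 2 -> t * T <= 3 -> D <= 2 * T -> D * l%:R <= T ->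
  0 <= th <= D / 2 -> 0 <= x <= 2 -> 0 <= eps <= c / T ->
  x = z%:~R / D + t * th + eps -> 0 <= xi - (D * l%:R + th) <= c ->
  `|x * xi - t * xi ^+ 2 / 2 - (x * th - t * th ^+ 2 / 2)
    - (z * l%:Z - p%:Z * l%:Z ^+ 2)%:~R| <= 10 * c.
Proof.
move=> T1 D0 c0 c1 tE tT DT DlT /andP[th0 th1] /andP[x0 x2] /andP[eps0 eps1] xE.
have T0 : 0 < T by lra.
pose u := xi - (D * l%:R + th); rewrite -/u => /andP[u0 u1].
have t0 : 0 <= t by rewrite tE divr_ge0 ?mulr_ge0 ?exprn_ge0// ltW.
have -> : (z * l%:Z - p%:Z * l%:Z ^+ 2)%:~R = z%:~R * l%:R - p%:R * l%:R ^+ 2 :> R.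
  by rewrite intrB !intrM.
have -> : x * xi - t * xi ^+ 2 / 2 - (x * th - t * th ^+ 2 / 2) -
    (z%:~R * l%:R - p%:R * l%:R ^+ 2) =
    eps * (D * l%:R) - t * (D * l%:R) * u + x * u - t * th * u - t * u ^+ 2 / 2.
  have -> : xi = u + D * l%:R + th by rewrite /u; ring.
  rewrite xE tE; field.
  by rewrite gt_eqF.
have l0 : 0 <= D * l%:R by rewrite mulr_ge0// ltW.
have e1 : 0 <= eps * (D * l%:R) <= c.
  rewrite mulr_ge0//= -[leRHS](divfK (negbT (gt_eqF T0))).
  by apply: ler_pM.
have e2 : 0 <= t * (D * l%:R) * u <= 3 * c.
  have h0 : 0 <= t * (D * l%:R) by exact: mulr_ge0.
  have h : t * (D * l%:R) <= 3 by apply: le_trans tT; rewrite ler_wpM2l.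
  by apply/andP; split; [exact: mulr_ge0|exact: ler_pM].
have e3 : 0 <= x * u <= 2 * c by apply/andP; split; [exact: mulr_ge0|exact: ler_pM].
have e4 : 0 <= t * th * u <= 3 * c.
  have h0 : 0 <= t * th by exact: mulr_ge0.
  have h : t * th <= 3 by apply: le_trans tT; rewrite ler_wpM2l//; lra.
  by apply/andP; split; [exact: mulr_ge0|exact: ler_pM].
have e5 : 0 <= t * u ^+ 2 / 2 <= c.
  have h0 : 0 <= t * u ^+ 2 by rewrite mulr_ge0// sqr_ge0.
  have h : t <= 3 by apply: le_trans tT; rewrite ler_peMr.
  have h1 : u ^+ 2 <= c ^+ 2 by rewrite lerXn2r// nnegrE ltW.
  have h2 : t * u ^+ 2 <= 3 * c ^+ 2 by apply: ler_pM => //; exact: sqr_ge0.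
  have h3 : c ^+ 2 <= c * 100^-1 by rewrite expr2 ler_wpM2l// ltW.
  by lra.
rewrite ler_norml; lra.
Qed.

End phase_algebra.

Section resonance.
Context {R : realType} (n : nat) (alpha a j e b : R).
Hypothesis expo : scale_exponents n alpha a j e b.
Variable T : R.
Hypothesis T1 : 1 <= T.
Local Notation c := (@tiny R n).
Local Notation D := ((freq_gap a T)%:R : R).
Local Notation K := (crt_modulus_prod n j T).
Local Notation J := (crt_modulus n j T).

Definition near_lattice (x : n.+2.-tuple R) := forall i, 1 <= tnth x i <= 2 /\
  exists m : nat, level_eta a j T i * m%:R <= tnth x i <= level_eta a j T i * m%:R + level_rho a j T i.

Let T0 : 0 < T. Proof. exact: lt_le_trans T1. Qed.
Let D0 : 0 < D. Proof. exact: freq_gap_gt0. Qed.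

Lemma freq_gap_le : D <= 2 * T.
Proof.
have [_ a1 _ _ _] := expo; have [_ h] := freq_gap_bounds expo T1.
apply: (le_trans h); rewrite ler_pM2l// -[leRHS]powRr1 ?(ltW T0)// ler_powR//.
exact: ltW.
Qed.

Lemma freq_mul_le l : (l < freq_count a T)%N -> D * l%:R <= T.
Proof.
move=> lL; have h : (freq_count a T)%:R <= T / D by rewrite truncn_le divr_ge0 ?(ltW T0) ?(ltW D0).
rewrite mulrC -ler_pdivlMr//; apply: le_trans h; by rewrite ler_nat ltnW.
Qed.

Lemma freq_shift_bounds (i : 'I_n.+1) : 0 <= freq_shift a j T i <= D / 2.
Proof.
rewrite /freq_shift divr_ge0 ?(ltW D0)//= ler_wpM2l ?(ltW D0)//.
have J0 : 0 < (J i)%:R :> R by rewrite ltr0n.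
by rewrite lef_pV2 ?posrE ?mulr_gt0// ler_peMr// ler1n.
Qed.

Let int_quotient (p m k : nat) : p = m %[mod k] ->
  exists z : int, m%:R - p%:R = z%:~R * k%:R :> R.
Proof.
move=> pm; exists ((m %/ k)%:Z - (p %/ k)%:Z).
rewrite {1}(divn_eq m k) {1}(divn_eq p k) pm !natrD !natrM intrB.
by rewrite -!pmulrn; ring.
Qed.

Lemma phaseE (t : R) (x xi : n.+2.-tuple R) : phase t x xi =
  2 * pi * \sum_i (tnth x i * tnth xi i - t * tnth xi i ^+ 2 / 2).
Proof.
rewrite /phase /normn2 /dotn sumrB mulrBr addrC; congr (_ - _).
rewrite !mulr_sumr; apply: eq_bigr => i _; lra.
Qed.

Lemma resonance (x : n.+2.-tuple R) : near_lattice x ->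
  exists t psi, [/\ (2 * T)^-1 <= t, t <= 3 / T &
    forall xi, tprod (freq_set a j T) xi -> 2^-1 <= cos (phase t x xi - psi)].
Proof.
move=> xT.
have /choice[m mP] i : exists m : nat,
    level_eta a j T i * m%:R <= tnth x i <= level_eta a j T i * m%:R + level_rho a j T i.
  by have [_] := xT i.
have [p0 p0P] := @chinese_family J (fun i => m (lift ord0 (inord i))) n.+1
  (fun i k ik => coprime_arithmetic_progression _ (ik : (i.+1 < k.+1 <= n.+1)%N)).
(* A multiple of K does not change the residues and moves t T to the lattice point below x_1;
   reducing [p0] modulo K keeps the correction below one step of that lattice. *)
pose p1 := (p0 %% K)%N; pose p := (K * m ord0 + p1)%N.
have JK (i : 'I_n.+1) : (J i %| K)%N by rewrite /crt_modulus_prod (bigD1 i)//= dvdn_mulr.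
have pP (i : 'I_n.+1) : p = m (lift ord0 i) %[mod J i].
  rewrite /p -modnDml (eqP (dvdn_mulr _ (JK i))) add0n /p1 modn_dvdm//.
  by rewrite p0P// inord_val.
pose t : R := 2 * p%:R / D ^+ 2.
have c0 : 0 < c := tiny_gt0 n; have c1 : c <= 100^-1 := tiny_le n.
have s1 : 1 <= Num.sqrt T by rewrite -sqrtr1 ler_wsqrtr.
have cs : c / Num.sqrt T <= 100^-1.
  apply: le_trans c1; rewrite ler_piMr ?(ltW c0)// invf_le1//; exact: lt_le_trans s1.
have t0 : 0 <= t by rewrite /t divr_ge0 ?mulr_ge0 ?exprn_ge0// ltW.
have x0T : `|tnth x ord0 - t * T| <= c / Num.sqrt T.
  have /andP[h1 h2] := mP ord0.
  have h3 : level_rho a j T (ord0 : 'I_n.+2) <= c / Num.sqrt T := level_rho_le_tiny a j T ord0.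
  have tTE : t * T = level_eta a j T (ord0 : 'I_n.+2) * (m ord0)%:R + 2 * p1%:R * T / D ^+ 2.
    by rewrite level_eta0 /t /p natrD natrM; field; rewrite gt_eqF.
  have h4 : 0 <= 2 * p1%:R * T / D ^+ 2 by rewrite divr_ge0 ?mulr_ge0 ?exprn_ge0 ?(ltW T0)// ltW.
  have h5 : 2 * p1%:R * T / D ^+ 2 <= c / Num.sqrt T.
    (* The correction vanishes if all the moduli are 1; otherwise a whole step of the first lattice
       is within the tolerance. *)
    have [q0|q0] := posnP (Num.truncn (tiny2 n * T `^ j)).
      have -> : p1 = 0%N.
        rewrite /p1; have -> : K = 1%N by rewrite /crt_modulus_prod big1// => i _; rewrite /crt_modulus q0 !muln0.
        by rewrite modn1.
      by rewrite mulr0 !mul0r divr_ge0 ?(ltW c0)// sqrtr_ge0.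
    apply: le_trans (crt_modulus_prod_small expo T1 q0).
    rewrite ler_pM2r ?invr_gt0 ?exprn_gt0// ler_pM2r// ler_pM2l// ler_nat ltnW// ltn_mod.
    exact: crt_modulus_prod_gt0.
  by rewrite tTE ler_norml; lra.
have [/andP[x01 x02] _] := xT ord0.
have tT : 2^-1 <= t * T <= 3 by move: x0T; rewrite ler_norml; lra.
have /andP[tT1 tT2] := tT.
pose kap (i : 'I_n.+2) : R := if unlift ord0 i is Some i' then
  tnth x i * freq_shift a j T i' - t * freq_shift a j T i' ^+ 2 / 2
  else tnth x i * T - t * T ^+ 2 / 2.
exists t, (2 * pi * \sum_i kap i); split.
- by rewrite invfM -ler_pdivlMr ?invr_gt0// invrK.
- by rewrite ler_pdivlMr.
move=> xi xiB.
have /choice[Z ZP] i : exists z : int,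
    `|tnth x i * tnth xi i - t * tnth xi i ^+ 2 / 2 - kap i - z%:~R| <= 10 * c.
  have := xiB i; rewrite /kap; case: (fintype.unliftP ord0 i) => [i' ->|->].
    move=> /freq_setSP[l [lL lP]].
    have [z zP] := int_quotient (pP i').
    exists (z * l%:Z - p%:Z * l%:Z ^+ 2).
    have [/andP[xi1 xi2] _] := xT (lift ord0 i'); have /andP[h1 h2] := mP (lift ord0 i').
    have h3 : level_rho a j T (lift ord0 i') <= c / T := level_rho_le_tiny a j T (lift ord0 i').
    have DT := freq_gap_le; have shift := freq_shift_bounds i'.
    apply: (@phase_other R T t _ _ c D (freq_shift a j T i')
      (tnth x (lift ord0 i') - level_eta a j T (lift ord0 i') * (m (lift ord0 i'))%:R)) => //.
    - exact: freq_mul_le.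
    - by rewrite xi2 (le_trans ler01).
    - by rewrite subr_ge0 h1 lerBlDl (le_trans h2)// lerD2l.
    - rewrite level_etaS /t /freq_shift.
      have J0 : 0 < (J i')%:R :> R by rewrite ltr0n.
      have -> : (m (lift ord0 i'))%:R = p%:R + z%:~R * (J i')%:R :> R by rewrite -zP addrC subrK.
      by field; rewrite !gt_eqF.
  move=> h; exists 0; rewrite subr0; apply: (phase_first _ _ _ _ _ x0T) => //.
  by move: h; rewrite freq_set0 /= in_itv.
pose err := \sum_i (tnth x i * tnth xi i - t * tnth xi i ^+ 2 / 2 - kap i - (Z i)%:~R).
have errle : `|2 * pi * err| <= 2^-1.
  have h : `|err| <= 20^-1.
    apply: (le_trans (ler_norm_sum _ _ _)).
    apply: (@le_trans _ _ (\sum_(i < n.+2) 10 * c)); first by apply: ler_sum.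
    rewrite sumr_const card_ord -[_ *+ n.+2]mulr_natl /c le_eqVlt; apply/orP; left; apply/eqP.
    have : 0 < n.+2%:R :> R by [].
    by move: (n.+2%:R : R) => N N0; field; rewrite gt_eqF.
  have pi0 := pi_gt0 R; have pi4 := @pi_lt4 R.
  rewrite normrM ger0_norm; last by rewrite mulr_ge0// ltW.
  apply: (@le_trans _ _ (8 * 20^-1)); last by lra.
  by apply: ler_pM => //; [rewrite mulr_ge0// ltW|lra].
rewrite phaseE -mulrBr -sumrB.
have -> : 2 * pi * \sum_i (tnth x i * tnth xi i - t * tnth xi i ^+ 2 / 2 - kap i) =
   2 * pi * err + 2 * pi * (\sum_i Z i)%:~R.
  have -> : err = \sum_i (tnth x i * tnth xi i - t * tnth xi i ^+ 2 / 2 - kap i) -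
      (\sum_i Z i)%:~R by rewrite /err sumrB rmorph_sum.
  by rewrite mulrBr subrK.
rewrite cos_add_2pi; apply: le_trans (cos_ge_1Bnorm _); lra.
Qed.

End resonance.

(** * Decay away from resonance *)

Section off_resonance.
Context {R : realType} (n : nat) (a j : R).
Local Notation Rn := (n.+2.-tuple R).
Local Notation c := (@tiny R n).

Lemma measurable_phase (t : R) (x : Rn) : measurable_fun setT (phase t x).
Proof.
rewrite /phase /normn2 /dotn.
apply: measurable_funD; apply: measurableT_comp => //.
  apply: measurable_funM => //; apply: measurable_sum => i.
  by apply: measurable_funX; exact: measurable_tnth.
apply: measurable_sum => i.
by apply: measurable_funM => //; exact: measurable_tnth.
Qed.

Lemma measurable_cos_phase (t psi : R) (x : Rn) :
  measurable_fun setT (fun xi => cos (phase t x xi - psi)).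
Proof.
apply: measurableT_comp; first exact: (continuous_measurable_fun (@continuous_cos R)).
by apply: measurable_funB => //; exact: measurable_phase.
Qed.

Lemma phase_tcons (t : R) (x : Rn) y0 (y : n.+1.-tuple R) :
  phase t x (tcons (y0, y)) = - pi * t * y0 ^+ 2 + 2 * pi * tnth x ord0 * y0 +
   2 * pi * \sum_(i < n.+1) (tnth x (lift ord0 i) * tnth y i - t * tnth y i ^+ 2 / 2).
Proof.
rewrite phaseE big_ord_recl tnth_tcons0 /=.
under eq_bigr do rewrite tnth_tconsS.
by rewrite mulrDr; congr (_ + _); field.
Qed.

Definition cube_freq (N T : R) : set Rn := cubeQ N `&` tprod (freq_set a j T).

Let S N T (i : 'I_n.+2) : set R := freq_set a j T i `&` `[- (N / 2), N / 2].

Lemma cube_freqE N T : cube_freq N T = tprod (S N T).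
Proof.
apply/seteqP; split=> x.
  by move=> [xN xT] i; split; [exact: xT|have := xN i; rewrite /= in_itv].
by move=> xS; split=> i; have [h1] := xS i => //; rewrite /= in_itv.
Qed.

Let measurable_S N T i : measurable (S N T i).
Proof. by apply: measurableI; [exact: measurable_freq_set|exact: measurable_itv]. Qed.

Let S0E N T : S N T ord0 =
  `[Num.max T (- (N / 2)), Num.min (T + c * Num.sqrt T) (N / 2)]%classic.
Proof.
rewrite /S freq_set0; apply/seteqP; split=> y /=; rewrite !in_itv/= ge_max le_min.
  by move=> [/andP[-> ->] /andP[-> ->]].
by move=> /andP[/andP[-> ->] /andP[-> ->]].
Qed.

(** In the first coordinate the phase has derivative 2 pi (x_1 - t xi_1), of modulus at least t T
    since t xi_1 >= 4 >= 2 x_1. A cube cuts the block in a product whose first factor is still an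
    interval, so N does not enter the bound. In the constant, 2 comes from the ends and 8 from the
    second derivative, with pi < 4. *)
Lemma oscillation_bound (T t psi N : R) (x : Rn) : 1 <= T -> 0 < t -> 4 <= t * T ->
  tnth x ord0 <= 2 ->
  (`| \int[@leb R n.+1]_(xi in cube_freq N T) (cos (phase t x xi - psi))%:E | <=
   (10 / (t * T) * ((freq_count a T)%:R * c) ^+ n.+1)%:E)%E.
Proof.
move=> T1 t0 tT x2.
have T0 : 0 < T by exact: lt_le_trans T1.
have c0 : 0 < c := tiny_gt0 n; have c1 : c <= 100^-1 := tiny_le n.
have Lc0 : 0 <= (freq_count a T)%:R * c by rewrite mulr_ge0// ltW.
have S_le i : (lebesgue_measure (S N T (lift ord0 i)) <= ((freq_count a T)%:R * c)%:E)%E.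
  rewrite -(lebesgue_freq_setS a j T i); apply: le_measure; rewrite ?inE.
  - exact: measurable_S.
  - exact: measurable_freq_set.
  - by move=> y [].
have S_fin i : lebesgue_measure (S N T (lift ord0 i)) \is a fin_num.
  by rewrite ge0_fin_numE// (le_lt_trans (S_le i)) ?ltry.
pose v := \prod_(i < n.+1) fine (lebesgue_measure (S N T (lift ord0 i))).
have vE : (\prod_(i < n.+1) lebesgue_measure (S N T (lift ord0 i)) = v%:E)%E.
  by rewrite /v -prodEFin; apply: eq_bigr => i _; rewrite fineK.
have v_le : v <= ((freq_count a T)%:R * c) ^+ n.+1.
  rewrite -[in leRHS](card_ord n.+1) -prodr_const; apply: ler_prod => i _.
  by rewrite fine_ge0//= -lee_fin fineK.
have k0 : 0 <= 10 / (t * T) by rewrite divr_ge0// mulr_ge0// ltW.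
apply: (@le_trans _ _ (10 / (t * T) * v)%:E); last by rewrite lee_fin ler_wpM2l.
rewrite cube_freqE; apply: (@integral_first_coordinate _ _ _ _ _ _ 1) => //.
- have := @lebesgue_freq_set0 R n a j T; set A := freq_set _ _ _ _ => AE.
  apply: (@le_lt_trans _ _ (lebesgue_measure A)); last by rewrite AE ltry.
  apply: le_measure; rewrite ?inE; [exact: measurable_S|exact: measurable_freq_set|by move=> y []].
- exact: measurable_cos_phase.
- by move=> xi; exact: cos_max.
move=> y; rewrite S0E; set u := Num.max _ _; set w := Num.min _ _.
have Tu : T <= u by rewrite le_max lexx.
have wT : w <= T + c * Num.sqrt T by rewrite ge_min lexx.
have [uw|wu] := leP u w; last first.
  by rewrite set_itv_ge ?integral_set0 ?abse0// bnd_simp -ltNge.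
under eq_integral do rewrite phase_tcons -addrA.
have tT0 : 0 < t * T by exact: mulr_gt0.
apply: (le_trans (quadratic_oscillation _ tT0 uw _)).
  move=> z /andP[uz _].
  have h : t * T <= t * z by rewrite ler_pM2l// (le_trans Tu).
  rewrite -normrN ger0_norm; last first.
    have := pi_gt0 R; nra.
  have := @pi_ge2 R; nra.
rewrite lee_fin.
have sT : Num.sqrt T <= T.
  rewrite -{2}(sqr_sqrtr (ltW T0)) expr2 ler_peMr ?sqrtr_ge0//.
  by rewrite -sqrtr1 ler_wsqrtr.
have wu : w - u <= T by have := sqrtr_ge0 T; nra.
have -> : `|- pi * t| = pi * t by rewrite mulNr normrN ger0_norm// mulr_ge0 ?pi_ge0// ltW.
apply: (@le_trans _ _ (2 / (t * T) + T * (2 * (4 * t) / (t * T) ^+ 2))); last first.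
  by rewrite le_eqVlt; apply/orP; left; apply/eqP; field; rewrite !gt_eqF.
rewrite lerD2l; apply: ler_pM => //; first by rewrite subr_ge0.
  by rewrite divr_ge0 ?exprn_ge0 ?mulr_ge0 ?pi_ge0// ltW.
by rewrite ler_wpM2r ?invr_ge0 ?exprn_ge0 ?(ltW tT0)// ler_pM2l// ler_pM2r// ltW// pi_lt4.
Qed.

End off_resonance.

(** * The sequence of scales and the divergence set *)

Section scale_sequence.
Context {R : realType} (n : nat) (alpha a j e b : R).
Hypothesis expo : scale_exponents n alpha a j e b.
Local Notation c := (@tiny R n).
Local Notation L := (@level_const R n).
Local Notation d := (n.+1%:R : R).
Local Notation N := (n.+2%:R : R).
Variable s : R.
Hypothesis s_lt : 2 * s < 2^-1 + d * (1 - a).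

(** Each factor 4 pays for rounding [freq_gap] up and [freq_count] down. *)
Definition volume_const : R := c ^+ n.+2 / 4 ^+ n.+1.

Lemma volume_const_gt0 : 0 < volume_const.
Proof. by rewrite divr_gt0 ?exprn_gt0// tiny_gt0. Qed.

Lemma freq_volume_ge (T : R) : 1 <= T -> 2 <= T `^ (1 - a) ->
  volume_const * T `^ (2^-1 + d * (1 - a)) <= freq_volume n a T.
Proof.
move=> T1 Ta2; have T0 : 0 < T by exact: lt_le_trans T1.
have c0 : 0 < c := tiny_gt0 n.
have [_ hD] := freq_gap_bounds expo T1.
have D0 : (0:R) < (freq_gap a T)%:R by exact: freq_gap_gt0.
have TaE : T = T `^ a * T `^ (1 - a).
  by rewrite -powR_gt0D// addrC subrK powRr1// ltW.
have Ta0 : 0 < T `^ a by rewrite powR_gt0.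
have h1 : T `^ (1 - a) / 2 <= T / (freq_gap a T)%:R.
  rewrite ler_pdivlMr//; apply: (@le_trans _ _ (T `^ (1 - a) / 2 * (2 * T `^ a))).
    by rewrite ler_wpM2l// divr_ge0// powR_ge0.
  by rewrite [leRHS]TaE le_eqVlt; apply/orP; left; apply/eqP; field.
have h2 : T `^ (1 - a) / 4 <= (freq_count a T)%:R.
  have := truncnS_gt (T / (freq_gap a T)%:R); rewrite -/(freq_count a T) -natr1.
  have : 1 <= (freq_count a T)%:R :> R.
    by rewrite ler1n truncn_gt0; lra.
  by lra.
rewrite /freq_volume /volume_const powR_gt0D// powR12_sqrt ?(ltW T0)//.
rewrite [d * _]mulrC powRrM powR_mulrn ?powR_ge0//.
rewrite [leLHS](_ : _ = c * Num.sqrt T * (T `^ (1 - a) / 4 * c) ^+ n.+1); last first.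
  move: c (T `^ (1 - a)) (Num.sqrt T) => u v w.
  by rewrite !exprMn exprVn exprS; ring.
rewrite ler_wpM2l ?mulr_ge0 ?sqrtr_ge0 ?(ltW c0)// lerXn2r ?nnegrE ?mulr_ge0 ?(ltW c0) ?powR_ge0//.
by rewrite ler_pM2r.
Qed.

(** In order: decay of the later blocks at earlier resonant times; room for the new Cantor intervals
    in the old ones; new steps below 1/T; new steps below T'^(-e/2); coarser scales costing at most
    T'^(1/(k+1)); enough intervals in each frequency direction; summable squared norms, where 128 is
    8^2 for the amplitudes times 2 for the sum. *)
Definition next_scale (k : nat) (T T' : R) : Prop :=
  [/\ 20 * 16 ^+ k / c * T <= T',
      (forall i : 'I_n.+2, 4 * L / level_rho a j T i <= T' `^ e),
      L * T <= T' `^ e, L <= T' `^ (e / 2) &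
  [/\ \prod_(i < n.+2) (4 / level_rho a j T i) <= T' `^ (k.+1%:R^-1),
      2 <= T' `^ (1 - a) &
      128 ^+ k * (10 * N) `^ s / volume_const <= T' `^ (2^-1 + d * (1 - a) - 2 * s)]].

Lemma powR_unbounded (x p : R) : 0 < p -> \forall T \near +oo, x <= T `^ p.
Proof.
move=> p0; exists (Num.max 1 (`|x| `^ p^-1)); split; first exact: num_real.
move=> T; rewrite gt_max => /andP[T1 xT].
rewrite (le_trans (ler_norm x))//.
have -> : `|x| = (`|x| `^ p^-1) `^ p by rewrite -powRrM mulVf ?gt_eqF// powRr1.
by rewrite ge0_ler_powR ?nnegrE ?powR_ge0 ?(ltW p0) ?(ltW xT)// (le_trans ler01)// ltW.
Qed.

(** Every requirement bounds a quantity determined by T by a positive power of T'. In the last one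
    the exponent is positive because the regularity is below the critical one. *)
Lemma exists_next_scale k (T : R) : exists T', next_scale k T T'.
Proof.
have [_ a1 _ _ [e0 _ _ _]] := expo.
have h1 : \forall T' \near +oo, 20 * 16 ^+ k / c * T <= T' by apply: nbhs_pinfty_ge; exact: num_real.
have h2 : \forall T' \near +oo, \sum_(i < n.+2) `|4 * L / level_rho a j T i| <= T' `^ e.
  exact: powR_unbounded.
have h3 := powR_unbounded (L * T) e0.
have h4 := @powR_unbounded L (e / 2) ltac:(lra).
have h5 := @powR_unbounded (\prod_(i < n.+2) (4 / level_rho a j T i)) (k.+1%:R^-1) ltac:(by rewrite invr_gt0).
have h6 := @powR_unbounded 2 (1 - a) ltac:(lra).
have h7 := @powR_unbounded (128 ^+ k * (10 * N) `^ s / volume_const)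
   (2^-1 + d * (1 - a) - 2 * s) ltac:(by rewrite subr_gt0).
have [T' [g1 [g2 [g3 [g4 [g5 [g6 g7]]]]]]] : exists T', _ := filter_ex (filterI h1
  (filterI h2 (filterI h3 (filterI h4 (filterI h5 (filterI h6 h7)))))).
exists T'; split => // i; apply: le_trans g2.
rewrite (bigD1 i)//= (le_trans (ler_norm _))// lerDl.
exact: sumr_ge0.
Qed.

Lemma exists_scale_sequence : exists T : nat -> R, T 0%N = 1 /\
  forall k, 1 <= T k /\ next_scale k (T k) (T k.+1).
Proof.
have /choice[f fP] (p : nat * R) := exists_next_scale p.1 p.2.
pose T := fix T k : R := if k is k'.+1 then f (k', T k') else 1.
exists T; split=> // k; split; last exact: (fP (k, T k)).
elim: k => [|k IH]//=.
have [h _ _ _ _] := fP (k, T k); apply: le_trans h.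
have c0 : 0 < c := tiny_gt0 n; have c1 : c <= 100^-1 := tiny_le n.
rewrite -[leLHS]mulr1; apply: ler_pM => //.
rewrite ler_pdivlMr// mul1r.
have : 1 <= 16 ^+ k :> R by rewrite exprn_ege1// ler1n.
lra.
Qed.

End scale_sequence.

(** * The product of Cantor sets *)

Section fractal.
Context {R : realType} (n : nat) (alpha a j e b : R).
Hypothesis expo : scale_exponents n alpha a j e b.
Hypothesis alpha_ge1 : 1 <= alpha.
Hypothesis alpha_le : alpha <= n.+2%:R.
Local Notation c := (@tiny R n).
Local Notation L := (@level_const R n).
Variables (s : R) (T : nat -> R).
Hypothesis T_start : T 0%N = 1.
Hypothesis T_scale : forall k, 1 <= T k /\ next_scale n a j e s k (T k) (T k.+1).

Lemma scale_ge1 k : 1 <= T k. Proof. by have [] := T_scale k. Qed.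

Lemma scale_growth k : 20 * 16 ^+ k / c * T k <= T k.+1.
Proof. by have [_ []] := T_scale k. Qed.

Lemma scale_double k : 2 * T k <= T k.+1.
Proof.
apply: le_trans (scale_growth k); have T1 := scale_ge1 k.
rewrite ler_pM2r; last by apply: lt_le_trans T1.
have c0 : 0 < c := tiny_gt0 n; have c1 : c <= 100^-1 := tiny_le n.
rewrite ler_pdivlMr//.
have : 1 <= 16 ^+ k :> R by rewrite exprn_ege1// ler1n.
lra.
Qed.

Lemma scale_homo : {homo T : k l / (k <= l)%N >-> k <= l}.
Proof.
apply: homo_leq => // [y x w|k]; first exact: le_trans.
by have := scale_double k; have := scale_ge1 k; lra.
Qed.

Lemma scale_ge_nat k : k%:R <= T k.
Proof.
elim: k => [|k IH]; first by rewrite (le_trans ler01)// scale_ge1.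
by rewrite -natr1; have := scale_double k; have := scale_ge1 k; lra.
Qed.

(** Generation 0 is an artificial unit step from which the interval [1, 2] arises; the lattices
    begin with [T 1]. *)
Definition fractal_eta (i : 'I_n.+2) k : R :=
  if k is _.+1 then level_eta a j (T k) i else 1.
Definition fractal_rho (i : 'I_n.+2) k : R :=
  if k is _.+1 then level_rho a j (T k) i else 1.
Local Notation eta := fractal_eta.
Local Notation rho := fractal_rho.

Definition fractal : set (n.+2.-tuple R) :=
  [set [tuple cantor_fun (eta i) (rho i) (u i) | i < n.+2] | u in
    [set u : 'I_n.+2 -> R | forall i, 0 <= u i <= 2^-1]].

Let T_gt0 k : 0 < T k. Proof. exact: lt_le_trans (scale_ge1 k). Qed.

Let eta_gt0 i k : 0 < eta i k.
Proof. by case: k => [|k]//=; rewrite level_eta_gt0 ?scale_ge1. Qed.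

Let rho_gt0 i k : 0 < rho i k.
Proof. by case: k => [|k]//=; rewrite level_rho_gt0 ?scale_ge1. Qed.

Let rho_le_eta i k : rho i k <= eta i k.
Proof. by case: k => [|k]//=; rewrite level_rho_le. Qed.

Let eta_le i k : eta i k.+1 <= L * T k.+1 `^ (- e).
Proof.
have [a_gt _ j0 _ [e0 e_le b_le [bE _ _ _]]] := expo.
have [h1 _ h2 _] := level_bounds expo (scale_ge1 k.+1).
have L0 : 0 <= L by rewrite (le_trans ler01)// level_const_ge1.
rewrite /=; case: (fintype.unliftP ord0 i) => [i' ->|->//].
rewrite (le_trans (h2 i'))// ler_wpM2l// ler_powR ?scale_ge1//; lra.
Qed.

Let L_le k x : L * x <= T k `^ e -> L * T k `^ (- e) * x <= 1.
Proof. by move=> h; rewrite powRN mulrAC ler_pdivrMr ?powR_gt0// mul1r. Qed.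

Let eta_next i k : eta i k.+1 <= (T k)^-1.
Proof.
have [_ [_ _ h _ _]] := T_scale k; have := L_le h => {}h.
apply: (le_trans (eta_le i k)).
by rewrite -[leLHS](mulfK (negbT (gt_eqF (T_gt0 k)))) -[leRHS]mul1r ler_pM2r ?invr_gt0.
Qed.

(** Bridges generation 0, where rho is 1, and the growth conditions, which are stated with the
    tolerances at [T 0 = 1]. *)
Let rho_level_le i k : level_rho a j (T k) i <= rho i k.
Proof.
case: k => [|k]//=; rewrite T_start (le_trans (level_rho_le_tiny _ _ _ _))//.
have c0 : 0 < c := tiny_gt0 n; have c1 : c <= 100^-1 := tiny_le n.
by case: ifP => _; rewrite ?sqrtr1 divr1; lra.
Qed.

Let eta_le_rho i k : 4 * eta i k.+1 <= rho i k.
Proof.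
apply: le_trans (rho_level_le i k); have [_ [_ h _ _ _]] := T_scale k.
have r0 : 0 < level_rho a j (T k) i by rewrite level_rho_gt0 ?scale_ge1.
have := h i; rewrite ler_pdivrMr// => {}h.
have := eta_le i k; rewrite powRN => h1.
apply: (@le_trans _ _ (4 * L / T k.+1 `^ e)); first by rewrite -mulrA ler_pM2l.
by rewrite ler_pdivrMr ?powR_gt0// [leRHS]mulrC.
Qed.

Let eta_sigma i k : eta i k.+1 <= T k.+1 `^ (- (e / 2)).
Proof.
have [_ [_ _ _ h _]] := T_scale k.
apply: (le_trans (eta_le i k)); have -> : - e = - (e / 2) + - (e / 2) by field.
rewrite powR_gt0D// mulrA -[leRHS]mul1r ler_wpM2r ?powR_ge0//.
by rewrite powRN ler_pdivrMr ?powR_gt0// mul1r.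
Qed.

Let density_le k : \prod_(i < n.+2) cantor_density eta rho i k <= T k.+1 `^ (k.+1%:R^-1).
Proof.
have [_ [_ _ _ _ [h _ _]]] := T_scale k; apply: le_trans h.
apply: ler_prod => i _; rewrite /cantor_density.
have M0 : (0 < cantor_count (eta i) (rho i) k)%N by exact: cantor_count_gt0.
have M1 : (cantor_count (eta i) (rho i) k)%:R^-1 <= 1 :> R by rewrite invf_le1 ?ltr0n// ler1n.
have M2 : 0 <= (cantor_count (eta i) (rho i) k)%:R^-1 :> R by rewrite invr_ge0.
have r0 : 0 < level_rho a j (T k) i by rewrite level_rho_gt0 ?scale_ge1.
apply/andP; split; first by rewrite divr_ge0 ?mulr_ge0// ltW.
apply: ler_pM; rewrite ?mulr_ge0 ?invr_ge0 ?(ltW (rho_gt0 _ _))//; first by lra.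
by rewrite lef_pV2 ?posrE.
Qed.

Lemma fractal_dim : (alpha%:E <= hausdorff_dim fractal)%E.
Proof.
have [_ _ _ _ [e0 e_le _ _]] := expo.
have L1 : 1 <= L := level_const_ge1 n.
have one k := one_scale_bound expo alpha_ge1 alpha_le L1 (scale_ge1 k.+1)
  (fun i => eta_gt0 i k.+1) (fun i => rho_gt0 i k.+1).
have bounds k := level_bounds expo (scale_ge1 k.+1).
apply: (@hausdorff_dim_ge _ _ (fun i => cantor_fun (eta i) (rho i))).
- by move=> u hu; exists u.
- move=> i u u' /andP[u0 _] /andP[u'0 _] E.
  apply/eqP; rewrite -subr_eq0 -normr_le0 leNgt; apply/negP => duu'.
  (* Equal images give |u - u'| <= 2 / M k for all k, and M k >= 2^k; this k is large enough to
     contradict it. *)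
  pose k := Num.truncn (2 / `|u - u'|).
  have := cantor_fun_modulus (eta_gt0 i) (rho_gt0 i) (rho_le_eta i) (eta_le_rho i) k u0 u'0.
  rewrite E subrr normr0 mul0r addr0 leNgt => /negP; apply.
  rewrite mulrC ltr_pdivrMr ?ltr0n ?cantor_count_gt0// mulrC -ltr_pdivrMr//.
  apply: (lt_le_trans (truncnS_gt _)); rewrite ler_nat -/k.
  apply: (@leq_trans (2 ^ k)%N); first exact: ltn_expl.
  by apply: cantor_count_expn.
- move=> beta beta0 ba.
  apply: (@multiscale_modulus _ _ eta rho T alpha (e / 2) ((2 * L) ^+ n.+2)) => //.
  + exact: scale_ge1.
  + exact: scale_homo.
  + move=> x; exists (Num.truncn x).+1.
    exact: lt_le_trans (truncnS_gt _) (scale_ge_nat _).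
  + by rewrite divr_gt0.
  + by lra.
  + by rewrite exprn_ge0// mulr_ge0// (le_trans ler01).
  + by move=> k r rT r1; have [h1 h2 h3 h4] := bounds k; have [h _] := one k h1 h2 h3 h4; exact: h.
  + by move=> k; have [h1 h2 h3 h4] := bounds k; have [_ h] := one k h1 h2 h3 h4.
Qed.

Lemma fractal_near_lattice x k : fractal x -> near_lattice a j (T k.+1) x.
Proof.
move=> [u hu <-] i; rewrite tnth_mktuple; have /andP[u0 u1] := hu i; split.
  have := cantor_fun_itv (eta_gt0 i) (rho_gt0 i) (rho_le_eta i) (eta_le_rho i) u0 _.
  by move=> /(_ ltac:(lra)) /andP[-> /= h]; apply: le_trans h _; rewrite /=; lra.
exact: (cantor_fun_lattice (eta_gt0 i) (rho_gt0 i) (rho_le_eta i) (eta_le_rho i) k u0).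
Qed.

End fractal.

(** * The initial datum *)

Section eventual_sums.
Context {R : realType}.

Lemma geometric_tail_le (v : nat -> R) (m M : nat) : (m <= M)%N ->
  (forall k, (m <= k)%N -> `|v k| <= 2^-1 ^+ k) ->
  `|\sum_(m <= k < M) v k| <= 2 * 2^-1 ^+ m.
Proof.
move=> mM vk; apply: (@le_trans _ _ (2 * 2^-1 ^+ m - 2 * 2^-1 ^+ M)); last first.
  by rewrite lerBlDr lerDl mulr_ge0// exprn_ge0// invr_ge0.
elim: M mM => [|M IH]; first by rewrite leqn0 => /eqP->; rewrite big_geq// normr0 subrr.
rewrite leq_eqVlt => /predU1P[->|]; first by rewrite big_geq// normr0 subrr.
rewrite ltnS => mM; rewrite big_nat_recr//=.
apply: (le_trans (ler_normD _ _)); have := IH mM; have := vk _ mM; rewrite exprS; lra.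
Qed.

Lemma exists_small_dyadic (k0 : nat) (eps : R) : 0 < eps ->
  exists m, (k0 <= m)%N /\ 4 * 2^-1 ^+ m <= eps.
Proof.
move=> e0; exists (k0 + (Num.truncn (4 / eps)).+1)%N; rewrite leq_addr; split=> //.
set q := (Num.truncn (4 / eps)).+1; have h : 4 / eps < q%:R by exact: truncnS_gt.
have h1 : q%:R <= 2 ^+ (k0 + q) :> R.
  by rewrite -natrX ler_nat (leq_trans (ltnW (ltn_expl q (ltnSn 1))))// leq_exp2l// leq_addl.
rewrite exprVn ler_pdivrMr ?exprn_gt0// mulrC -ler_pdivrMr//.
by apply: le_trans h1; exact: ltW.
Qed.

(** Dominated convergence for a series whose terms are eventually constant in N. The domination
    starts at [k0]; the earlier terms stay explicit, which locates the limit as well as proving that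
    it exists. *)
Lemma eventually_sum_cvg (P : R -> R) (a : nat -> R -> R) (u : nat -> R) (k0 : nat) :
  (forall N, exists M0, forall M, (M0 <= M)%N -> P N = \sum_(0 <= k < M) a k N) ->
  (forall k, \forall N \near +oo, a k N = u k) ->
  (forall k N, (k0 <= k)%N -> `|a k N| <= 2^-1 ^+ k) ->
  exists S, P N @[N --> +oo] --> S /\ `|S - \sum_(0 <= k < k0) u k| <= 2 * 2^-1 ^+ k0.
Proof.
move=> PE au a_le.
have u_le k : (k0 <= k)%N -> `|u k| <= 2^-1 ^+ k.
  by move=> kk; have [N <-] := filter_ex (au k); exact: a_le.
(* The undominated terms are removed, so that the series can be compared with a geometric one. *)
pose u' k := if (k < k0)%N then 0 else u k.
have u'_le k : `|u' k| <= 2^-1 ^+ k.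
  by rewrite /u'; case: ltnP => [_|/u_le//]; rewrite normr0 exprn_ge0// invr_ge0.
have cu' : cvgn (series u').
  apply: normed_cvg; apply: (@series_le_cvg _ _ (geometric 1 2^-1)) => //.
  - by move=> k /=; exact: normr_ge0.
  - by move=> k; rewrite /geometric/= mul1r exprn_ge0// invr_ge0.
  - by move=> k; rewrite /geometric/= mul1r; exact: u'_le.
  by apply: is_cvg_geometric_series; rewrite ger0_norm; lra.
pose U m := \sum_(0 <= k < m) u k.
pose S := U k0 + limn (series u').
have US m : (k0 <= m)%N -> `|S - U m| <= 2 * 2^-1 ^+ m.
  move=> km; apply/ler_addgt0Pr => eps eps0.
  have /cvgrPdist_le /(_ _ eps0) [M1 _ M1P] : series u' @ \oo --> limn (series u') by [].
  pose M := maxn m M1; have := M1P M; rewrite /= leq_maxr => /(_ isT) hM.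
  have kM : (k0 <= M)%N by rewrite (leq_trans km)// leq_maxl.
  have UM : U M = U k0 + series u' M.
    rewrite /U (big_cat_nat (n := k0))//=; congr (_ + _).
    rewrite /series /= [RHS](big_cat_nat (n := k0))//=.
    rewrite [X in _ = X + _]big_nat_cond [X in _ = X + _]big1 ?add0r//; last first.
      by move=> k /andP[/andP[_ kk] _]; rewrite /u' kk.
    by apply: eq_big_nat => k /andP[kk _]; rewrite /u' ltnNge kk.
  have UMm : U M - U m = \sum_(m <= k < M) u k.
    by rewrite /U [X in X - _](big_cat_nat (n := m))//= ?leq_maxl// addrAC subrr add0r.
  have -> : S - U m = (U M - U m) + (limn (series u') - series u' M).
    by rewrite /S UM; ring.
  apply: (le_trans (ler_normD _ _)); apply: lerD => //.
  rewrite UMm; apply: geometric_tail_le; first by rewrite leq_maxl.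
  by move=> k mk; apply: u_le; exact: leq_trans mk.
exists S; split; last exact: US.
apply/cvgrPdist_le => eps eps0.
have [m [km me]] := exists_small_dyadic k0 eps0.
have near_m : \forall N \near +oo, forall i : 'I_m, a i N = u i.
  by apply: filter_forall => i; exact: au.
near=> N.
have aN : forall i : 'I_m, a i N = u i by near: N.
have [M0 hM] := PE N; pose M := maxn m M0.
rewrite (hM M); last by rewrite leq_maxr.
rewrite (big_cat_nat (n := m))//= ?leq_maxl//.
have -> : \sum_(0 <= k < m) a k N = U m.
  by rewrite /U !big_mkord; apply: eq_bigr => i _; exact: aN.
rewrite opprD addrA; apply: (le_trans (ler_normB _ _)).
have h1 := US m km.
have h2 : `|\sum_(m <= k < M) a k N| <= 2 * 2^-1 ^+ m.
  apply: geometric_tail_le; first by rewrite leq_maxl.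
  by move=> k mk; apply: a_le; exact: leq_trans mk.
lra.
Unshelve. all: by end_near. Qed.

End eventual_sums.

Section initial_datum.
Context {R : realType} (n : nat) (alpha a j e b : R).
Hypothesis expo : scale_exponents n alpha a j e b.
Local Notation c := (@tiny R n).
Local Notation Rn := (n.+2.-tuple R).
Local Notation mu := (@leb R n.+1).
Variables (s : R) (T : nat -> R).
Hypothesis s_ge0 : 0 <= s.
Hypothesis T_start : T 0%N = 1.
Hypothesis T_scale : forall k, 1 <= T k /\ next_scale n a j e s k (T k) (T k.+1).

Let T_ge1 := scale_ge1 T_scale.
Let T_gt0 k : 0 < T k. Proof. exact: lt_le_trans (T_ge1 k). Qed.
Let c0 : 0 < c := tiny_gt0 n.
Let c1 : c <= 100^-1 := tiny_le n.

Definition block k : set Rn := tprod (freq_set a j (T k.+1)).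
Definition block_volume k : R := freq_volume n a (T k.+1).
Definition amplitude k : R := 8 ^+ k / block_volume k.
Local Notation B := block.
Local Notation vol := block_volume.
Local Notation A := amplitude.

Lemma measurable_block k : measurable (B k).
Proof. by apply: measurable_tprod => i; exact: measurable_freq_set. Qed.

Lemma leb_block k : mu (B k) = (vol k)%:E. Proof. exact: leb_freq. Qed.

Lemma block_volume_gt0 k : 0 < vol k.
Proof.
have [_ [_ _ _ _ [_ h _]]] := T_scale k.
apply: lt_le_trans (freq_volume_ge expo (T_ge1 k.+1) h).
by rewrite mulr_gt0 ?powR_gt0// volume_const_gt0.
Qed.

Lemma amplitude_ge0 k : 0 <= A k.
Proof. by rewrite divr_ge0 ?exprn_ge0// ltW// block_volume_gt0. Qed.

Let sqrt_le k : Num.sqrt (T k) <= T k.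
Proof.
rewrite -{2}(sqr_sqrtr (ltW (T_gt0 k))) expr2 ler_peMr ?sqrtr_ge0//.
by rewrite -sqrtr1 ler_wsqrtr.
Qed.

Lemma block_first k xi : B k xi -> T k.+1 <= tnth xi ord0 < 2 * T k.+1.
Proof.
move=> /(_ ord0); rewrite freq_set0 /= in_itv/= => /andP[-> h] /=.
apply: (le_lt_trans h); have := sqrt_le k.+1; have := T_gt0 k.+1; have := sqrtr_ge0 (T k.+1).
move: (Num.sqrt _) => r r0 T0 rT.
have : c * r <= 100^-1 * r by rewrite ler_wpM2r.
lra.
Qed.

Lemma block_coord k xi i : B k xi -> `|tnth xi i| <= 3 * T k.+1.
Proof.
move=> xiB; have T0 := T_gt0 k.+1; case: (fintype.unliftP ord0 i) => [i' ->|->]; last first.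
  by have /andP[h1 h2] := block_first xiB; rewrite ger0_norm; lra.
have := xiB (lift ord0 i') => /freq_setSP[l [lL /andP[h1 h2]]].
have DT := freq_gap_le expo (T_ge1 k.+1).
have lT := freq_mul_le (T_ge1 k.+1) lL.
have /andP[s0 s1] := freq_shift_bounds a j (T k.+1) i'.
have D0 : 0 <= (freq_gap a (T k.+1))%:R :> R by [].
have T1 := T_ge1 k.+1.
have l0 : 0 <= (freq_gap a (T k.+1))%:R * l%:R :> R by rewrite mulr_ge0.
have main (x th t c' y D : R) : c' <= 100^-1 -> 0 <= x - (y + th) -> x - (y + th) <= c' ->
    D <= 2 * t -> y <= t -> 0 <= th -> th <= D / 2 -> 1 <= t -> 0 <= y -> `|x| <= 3 * t.
  by move=> *; rewrite ger0_norm; lra.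
exact: (main _ _ _ _ _ _ c1 h1 h2 DT lT s0 s1 T1 l0).
Qed.

Lemma block_disjoint k l xi : B k xi -> B l xi -> k = l.
Proof.
wlog kl : k l / (k <= l)%N.
  by move=> H h1 h2; case/orP: (leq_total k l) => [/H->//|/H->].
move=> /block_first/andP[_ h1] /block_first/andP[h2 _].
apply/eqP; rewrite eqn_leq kl leqNgt; apply/negP => lt_kl.
have := scale_homo T_scale (lt_kl : (k.+2 <= l.+1)%N).
have := scale_double T_scale k.+1; lra.
Qed.

Definition partial_hat m (xi : Rn) : R := \sum_(0 <= k < m) A k * \1_(B k) xi.
(* The truncation is harmless: [B k] lies in [xi_0 >= T k.+1 >= k.+1]. *)
Definition datum_hat (xi : Rn) : R := partial_hat (Num.truncn `|tnth xi ord0|).+1 xi.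

Lemma partial_hat_stable m M xi : (m <= M)%N ->
  (forall k, (m <= k)%N -> ~ B k xi) -> partial_hat M xi = partial_hat m xi.
Proof.
move=> mM noB; rewrite /partial_hat (big_cat_nat (n := m))//= [X in _ + X]big_nat_cond.
rewrite [X in _ + X]big1 ?addr0// => k /andP[/andP[mk _] _].
by rewrite indicE memNset ?mulr0//; exact: noB.
Qed.

Let noB_large k xi : (Num.truncn `|tnth xi ord0| < k)%N -> ~ B k xi.
Proof.
move=> lk /block_first/andP[h _].
have := truncnS_gt `|tnth xi ord0|; rewrite ltNge => /negP; apply.
rewrite (le_trans _ (ler_norm _))// (le_trans _ h)// (le_trans _ (scale_ge_nat T_scale _))//.
by rewrite ler_nat leqW.
Qed.

Lemma partial_hat_eventually M xi : (Num.truncn `|tnth xi ord0| < M)%N ->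
  partial_hat M xi = datum_hat xi.
Proof. by move=> h; apply: partial_hat_stable => // k; exact: noB_large. Qed.

Lemma datum_hat_block k xi : B k xi -> datum_hat xi = A k.
Proof.
move=> Bk; rewrite -(@partial_hat_eventually (maxn k (Num.truncn `|tnth xi ord0|)).+1); last first.
  by rewrite ltnS leq_maxr.
have kM : (k < (maxn k (Num.truncn `|tnth xi ord0|)).+1)%N by rewrite ltnS leq_maxl.
rewrite /partial_hat big_mkord (bigD1 (Ordinal kM))//= indicE mem_set// mulr1 big1 ?addr0// => l lk.
rewrite indicE memNset ?mulr0// => Bl; move/negP: lk; apply; apply/eqP/val_inj => /=.
exact: block_disjoint Bl Bk.
Qed.

Lemma datum_hat_outside xi : (forall k, ~ B k xi) -> datum_hat xi = 0.
Proof.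
by move=> noB; rewrite /datum_hat (@partial_hat_stable 0)// /partial_hat big_geq.
Qed.

Lemma measurable_partial_hat m : measurable_fun setT (partial_hat m).
Proof.
rewrite /partial_hat; apply: measurable_sum => k.
by apply: measurable_funM => //; apply: measurable_indic; exact: measurable_block.
Qed.

Lemma measurable_datum_hat : measurable_fun setT datum_hat.
Proof.
apply: (measurable_fun_cvg measurable_partial_hat) => xi _.
apply: cvg_near_cst; exists (Num.truncn `|tnth xi ord0|).+1 => // M.
exact: partial_hat_eventually.
Qed.

Lemma block_normn2 k xi : B k xi -> 1 + normn2 xi <= 10 * n.+2%:R * T k.+1 `^ 2.
Proof.
move=> xiB; have T1 := T_ge1 k.+1; have T0 := T_gt0 k.+1.
have -> : T k.+1 `^ 2 = T k.+1 ^+ 2 by rewrite -powR_mulrn// ltW.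
have h : normn2 xi <= n.+2%:R * (9 * T k.+1 ^+ 2).
  rewrite /normn2 (le_trans (_ : _ <= \sum_(i < n.+2) 9 * T k.+1 ^+ 2))//; last first.
    by rewrite sumr_const card_ord -[_ *+ _]mulr_natl.
  apply: ler_sum => i _; have := block_coord i xiB => h.
  rewrite -real_normK ?num_real// (_ : 9 * T k.+1 ^+ 2 = (3 * T k.+1) ^+ 2); last by ring.
  by rewrite lerXn2r ?nnegrE// mulr_ge0// ltW.
have h1 : 1 <= n.+2%:R * T k.+1 ^+ 2.
  by rewrite -[leLHS]mulr1 ler_pM ?ler1n// expr_ge1// ltW.
lra.
Qed.

Definition sobolev_term k : R := A k ^+ 2 * (10 * n.+2%:R * T k.+1 `^ 2) `^ s.

Lemma sobolev_term_ge0 k : 0 <= sobolev_term k.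
Proof. by rewrite mulr_ge0 ?sqr_ge0 ?powR_ge0. Qed.

(** The squared amplitude times the volume is 64^k / vol, and by the last growth condition the
    weight divided by [vol] is at most 128^(-k). *)
Lemma sobolev_term_le k : sobolev_term k * vol k <= 2^-1 ^+ k.
Proof.
have [_ [_ _ _ _ [_ h6 h7]]] := T_scale k.
have T0 := T_gt0 k.+1; have v0 := block_volume_gt0 k.
have vc0 := @volume_const_gt0 R n.
set E := 2^-1 + n.+1%:R * (1 - a) in h7.
have hv : volume_const n * T k.+1 `^ E <= vol k := freq_volume_ge expo (T_ge1 k.+1) h6.
have -> : sobolev_term k * vol k = 64 ^+ k * (10 * n.+2%:R) `^ s * T k.+1 `^ (2 * s) / vol k.
  rewrite /sobolev_term /A powRM ?powR_ge0 ?mulr_ge0// -powRrM.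
  rewrite expr_div_n -exprM mulnC exprM (_ : 8 ^+ 2 = 64 :> R); last by ring.
  by field; rewrite gt_eqF.
rewrite ler_pdivrMr//; apply: le_trans (ler_wpM2l _ hv); last by rewrite exprn_ge0// invr_ge0.
have -> : T k.+1 `^ E = T k.+1 `^ (E - 2 * s) * T k.+1 `^ (2 * s).
  by rewrite -powR_gt0D// subrK.
rewrite mulrA mulrA ler_wpM2r ?powR_ge0//.
rewrite ler_pdivrMr// in h7.
rewrite (_ : 64 = 2^-1 * 128); last by field.
rewrite [(2^-1 * 128) ^+ k]exprMn -[leLHS]mulrA; apply: ler_wpM2l.
  by rewrite exprn_ge0// invr_ge0.
by rewrite [leRHS]mulrC.
Qed.

(** The blocks are disjoint, so at each frequency the integrand is at most a single term of the
    series [G], which is integrated termwise. *)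
Lemma datum_in_Hs (s' : R) : s' <= s -> in_Hs_hat s' datum_hat (fun=> 0).
Proof.
move=> ss'; split; first exact: measurable_datum_hat.
split; first exact: measurable_cst.
pose G (xi : Rn) : \bar R := (\sum_(k <oo) (sobolev_term k * \1_(B k) xi)%:E)%E.
have mG k : measurable_fun setT (fun xi : Rn => (sobolev_term k * \1_(B k) xi)%:E).
  apply/measurable_EFinP; apply: measurable_funM => //.
  by apply: measurable_indic; exact: measurable_block.
have G0 k (xi : Rn) : (0 <= (sobolev_term k * \1_(B k) xi)%:E)%E.
  by rewrite lee_fin mulr_ge0 ?sobolev_term_ge0.
pose F (xi : Rn) : R := (1 + normn2 xi) `^ s' * (datum_hat xi ^+ 2 + 0 ^+ 2).
have mF : measurable_fun setT F.
  apply: measurable_funM; last first.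
    by apply: measurable_funD => //; apply: measurable_funX; exact: measurable_datum_hat.
  apply: (measurableT_comp (measurable_powR _)); apply: measurable_funD => //.
  apply: measurable_sum => i; apply: measurable_funX; exact: measurable_tnth.
suff : (\int[mu]_(xi in setT) (F xi)%:E < +oo)%E by [].
have FG : (\int[mu]_(xi in setT) (F xi)%:E <= \int[mu]_(xi in setT) G xi)%E.
  apply: (ge0_le_integral mu measurableT).
  - by move=> xi _; rewrite lee_fin mulr_ge0 ?powR_ge0// addr_ge0 ?sqr_ge0.
  - exact/measurable_EFinP.
  - by apply: ge0_emeasurable_sum => // k xi _ _; exact: G0.
  move=> xi _; have [[k Bk]|noB] := pselect (exists k, B k xi); last first.
    rewrite /F datum_hat_outside; last by move=> k Bk; apply: noB; exists k.
    by rewrite expr0n addr0 mulr0; exact: nneseries_ge0.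
  rewrite /F (datum_hat_block Bk) expr0n addr0 /G.
  apply: (@le_trans _ _ (\sum_(0 <= l < k.+1) (sobolev_term l * \1_(B l) xi)%:E)%E); last first.
    by apply: nneseries_lim_ge => l _ _; exact: G0.
  rewrite big_nat_recr//= indicE mem_set// mulr1.
  apply: (@le_trans _ _ (sobolev_term k)%:E); last first.
    by rewrite leeDr// sume_ge0// => l _; exact: G0.
  rewrite lee_fin /sobolev_term mulrC ler_wpM2l ?sqr_ge0//.
  have h1 : 1 <= 1 + normn2 xi by rewrite lerDl sumr_ge0// => i _; exact: sqr_ge0.
  apply: (@le_trans _ _ ((1 + normn2 xi) `^ s)); first by rewrite ler_powR.
  rewrite ge0_ler_powR// ?nnegrE ?mulr_ge0 ?powR_ge0//; last exact: block_normn2.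
  by rewrite (le_trans ler01).
apply: (le_lt_trans FG); rewrite (integral_nneseries mu measurableT mG)//.
apply: (@le_lt_trans _ _ (\sum_(k <oo) (2 / (2 ^ k.+1)%:R)%:E)%E); last first.
  by rewrite (le_lt_trans (epsilon_trick0 _ _))// ltry.
apply: lee_nneseries => k _.
  by move=> _; apply: integral_ge0 => xi _; exact: G0.
under eq_integral do rewrite EFinM.
rewrite (ge0_integralZl_EFin mu measurableT) ?sobolev_term_ge0//; last first.
  by apply/measurable_EFinP; apply: measurable_indic; exact: measurable_block.
rewrite integral_indic ?setIT//; last exact: measurable_block.
rewrite [X in (_ * X)%E](leb_block k : _ = _) -EFinM lee_fin (le_trans (sobolev_term_le k))//.
by rewrite exprVn natrX exprS invfM mulrA divff// mul1r.
Qed.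

Lemma integral_partial_hat (D : set Rn) (g : Rn -> R) m : measurable D -> (mu D < +oo)%E ->
  measurable_fun setT g -> (forall xi, `|g xi| <= 1) ->
  fine (\int[mu]_(xi in D) (partial_hat m xi * g xi)%:E) =
  \sum_(0 <= k < m) A k * fine (\int[mu]_(xi in D `&` B k) (g xi)%:E).
Proof.
move=> mD Dfin mg g1.
have mB k : measurable_fun setT (fun xi : Rn => \1_(B k) xi * g xi).
  by apply: measurable_funM => //; apply: measurable_indic; exact: measurable_block.
have iB k : mu.-integrable D (fun xi => (\1_(B k) xi * g xi)%:E).
  apply: (integrable_bounded (c := 1)) => // xi.
  by rewrite indicE normrM; case: (_ \in _); rewrite ?normr1 ?normr0 ?mul1r ?mul0r.
have iAB k : mu.-integrable D (fun xi => (A k * (\1_(B k) xi * g xi))%:E).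
  by apply: (integrableZl mD (A k) (iB k)).
have iDB k : mu.-integrable (D `&` B k) (EFin \o g).
  have mDB : measurable (D `&` B k) by apply: measurableI => //; exact: measurable_block.
  by apply: (integrableS mD mDB) => //; exact: (integrable_bounded mD Dfin mg g1).
transitivity (fine (\int[mu]_(xi in D) \sum_(0 <= k < m) (A k * (\1_(B k) xi * g xi))%:E)).
  congr fine; apply: eq_integral => xi _.
  by rewrite sumEFin /partial_hat mulr_suml; congr EFin; apply: eq_bigr => k _; rewrite mulrA.
rewrite (integral_sum mD iAB) -[RHS]/(fine (EFin _)) -sumEFin; congr fine.
apply: eq_bigr => k _; rewrite EFinM fineK; last by apply: integrable_fin_num (iDB k); apply: measurableI => //; exact: measurable_block.
rewrite integral_mkcondr -(integralZl mD); last first.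
  rewrite (_ : _ \_ _ = fun xi => (\1_(B k) xi * g xi)%:E)//.
  by apply/funext => xi; rewrite patchE indicE; case: ifP; rewrite ?mul1r ?mul0r.
apply: eq_integral => xi _; rewrite patchE indicE.
by case: ifP; rewrite ?mul1r ?mul0r ?mulr0 ?mule0.
Qed.

Lemma measurable_cubeQ (N : R) : measurable (cubeQ N : set Rn).
Proof. exact: measurable_box. Qed.

Lemma leb_cubeQ_fin (N : R) : (mu (cubeQ N) < +oo)%E.
Proof.
have N0 : - `|N| <= `|N| by rewrite (le_trans _ (normr_ge0 _))// oppr_le0.
apply: (@le_lt_trans _ _ (mu (box (fun=> - `|N|) (fun=> `|N|)))); last by rewrite leb_box// ltry.
apply: lebn_le => xi h i; have /andP[h1 h2] := h i.
have := ler_norm N; have := ler_norm (- N); rewrite normrN => *.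
by apply/andP; split; lra.
Qed.

(** * Evolution of the datum *)

Section evolution.
Variables (t : R) (x : Rn).
Local Notation wave psi := (fun xi : Rn => cos (phase t x xi - psi)).

(** Real part of the cut-off solution multiplied by e^(-i psi). The values 0 and pi/2 of [psi] give
    the real and imaginary parts, and the resonant phase gives the direction in which one block is
    large; a single family of real integrals serves all three. *)
Definition wave_cut psi N : R := fine (\int[mu]_(xi in cubeQ N) (datum_hat xi * wave psi xi)%:E).
Definition wave_term psi k N : R :=
  A k * fine (\int[mu]_(xi in cubeQ N `&` B k) (wave psi xi)%:E).
Definition wave_block psi k : R := A k * fine (\int[mu]_(xi in B k) (wave psi xi)%:E).

Let wave1 psi xi : `|wave psi xi| <= 1. Proof. exact: cos_max. Qed.

Lemma wave_cut_sum psi N : exists M0, forall M, (M0 <= M)%N ->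
  wave_cut psi N = \sum_(0 <= k < M) wave_term psi k N.
Proof.
exists (Num.truncn `|N|).+1 => M NM.
rewrite -integral_partial_hat//; [|exact: measurable_cubeQ|exact: leb_cubeQ_fin
  |exact: measurable_cos_phase].
congr fine; apply: eq_integral => xi; rewrite inE => xiN.
rewrite partial_hat_eventually// (leq_ltn_trans _ NM)//.
apply: le_truncn; have /andP[h1 h2] := xiN ord0.
have := ler_norm N; have := normr_ge0 N; rewrite ler_norml => *; apply/andP; split; lra.
Qed.

Lemma wave_term_near psi k : \forall N \near +oo, wave_term psi k N = wave_block psi k.
Proof.
near=> N; rewrite /wave_term (_ : cubeQ N `&` B k = B k)//.
apply/seteqP; split=> [xi []|xi Bxi]//; split=> // i.
have := block_coord i Bxi; rewrite ler_norml => /andP[h1 h2].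
have hN : 6 * T k.+1 <= N by near: N; apply: nbhs_pinfty_ge; rewrite num_real.
by apply/andP; split; lra.
Unshelve. all: by end_near. Qed.

(** The block volume is c sqrt(T k.+1) V and the oscillation bound 10 V / (t T k.+1), so with mass
    8^k there remains at most 10 * 8^k / (c t T k.+1). As t >= 1 / (2 T K.+1), the growth of the
    scales gives t T k.+1 >= 10 * 16^k / c. *)
Lemma wave_term_small psi k K N : (K < k)%N -> tnth x ord0 <= 2 -> (2 * T K.+1)^-1 <= t ->
  `|wave_term psi k N| <= 2^-1 ^+ k.
Proof.
move=> Kk x2 tT; have TK0 := T_gt0 K.+1; have Tk1 := T_ge1 k.+1.
have t0 : 0 < t by apply: lt_le_trans tT; rewrite invr_gt0 mulr_gt0.
have p1 : 1 <= 16 ^+ k :> R by rewrite exprn_ege1// ler1n.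
have growth : 10 * 16 ^+ k / c <= t * T k.+1.
  have h1 := scale_homo T_scale (Kk : (K.+1 <= k)%N).
  have h2 : 20 * 16 ^+ k / c * T K.+1 <= T k.+1.
    apply: le_trans (scale_growth T_scale k).
    by rewrite ler_wpM2l// divr_ge0// ?mulr_ge0// ?(ltW c0)// exprn_ge0.
  apply: (le_trans _ (ler_pM _ _ tT h2)); last 2 first.
  - by rewrite invr_ge0 mulr_ge0// ltW.
  - by rewrite !mulr_ge0 ?invr_ge0 ?exprn_ge0 ?(ltW c0) ?(ltW TK0).
  move: (16 ^+ k) (tiny _) c0 => p c' c'0.
  by rewrite le_eqVlt; apply/orP; left; apply/eqP; field; rewrite !gt_eqF.
have tT4 : 4 <= t * T k.+1.
  apply: le_trans growth; move: (16 ^+ k) (tiny _) c0 c1 p1 => p c' c'0 c'1 p1.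
  rewrite ler_pdivlMr//; lra.
have bound := oscillation_bound a j psi N Tk1 t0 tT4 x2.
have v0 := block_volume_gt0 k; have sT : 1 <= Num.sqrt (T k.+1).
  by rewrite -(@sqrtr1 R) ler_wsqrtr.
rewrite normrM (ger0_norm (amplitude_ge0 k)).
set I := integral _ _ _; set V := ((freq_count a (T k.+1))%:R * c) ^+ n.+1 in bound.
have hI : `|fine I| <= 10 / (t * T k.+1) * V.
  move: bound; rewrite -/I; case: I => [r| |]//=.
rewrite /amplitude /block_volume /freq_volume -/V in v0 *.
have V0 : 0 < V.
  by move: v0; rewrite pmulr_rgt0// mulr_gt0// (lt_le_trans ltr01).
apply: (le_trans (ler_wpM2l _ hI)); first by rewrite divr_ge0 ?exprn_ge0// ltW.
move: V V0 {hI bound v0} => V V0.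
have -> : 2^-1 ^+ k = 8 ^+ k / 16 ^+ k :> R.
  by rewrite -expr_div_n; congr (_ ^+ _); field.
have q0 : 0 <= 8 ^+ k :> R by rewrite exprn_ge0.
move: (8 ^+ k) (16 ^+ k) (Num.sqrt _) (t * T k.+1) (tiny _) c0 p1 q0 sT growth tT4.
move=> q p r u c' c'0 p1 q0 r1; rewrite ler_pdivrMr// => h u4.
rewrite [leLHS](_ : _ = q * (10 / (c' * r * u))); last first.
  by field; rewrite !gt_eqF//; lra.
rewrite ler_wpM2l// -[leRHS]mul1r ler_pdivlMr; last lra.
have cu : 10 <= c' * u / p by rewrite ler_pdivlMr; lra.
rewrite mulrAC ler_pdivrMr; last by rewrite !mulr_gt0//; lra.
nra.
Qed.

Let wave_integrable psi k : mu.-integrable (B k) (fun xi => (wave psi xi)%:E).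
Proof.
apply: (integrable_bounded (c := 1)) => //; [exact: measurable_block| |exact: measurable_cos_phase].
by apply: (@le_lt_trans _ _ (vol k)%:E); [rewrite -leb_block|exact: ltry].
Qed.

Lemma wave_block_le psi k : `|wave_block psi k| <= 8 ^+ k.
Proof.
have v0 := block_volume_gt0 k.
rewrite normrM (ger0_norm (amplitude_ge0 k)) /amplitude mulrAC ler_pdivrMr//.
rewrite ler_wpM2l ?exprn_ge0//.
have fin := integrable_fin_num (measurable_block k) (wave_integrable psi k).
rewrite -lee_fin -abse_EFin fineK// -leb_block.
apply: (le_trans (le_abse_integral mu (measurable_block k) _)).
  exact: (measurable_int _ (wave_integrable psi k)).
rewrite -[leRHS]mul1e -integral_cst; last exact: measurable_block.
apply: ge0_le_integral => //; first exact: measurable_block.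
  by apply: measurableT_comp => //; exact: (measurable_int _ (wave_integrable psi k)).
by move=> xi _; rewrite lee_fin.
Qed.

Lemma wave_block_ge psi k : (forall xi, B k xi -> 2^-1 <= wave psi xi) ->
  8 ^+ k / 2 <= wave_block psi k.
Proof.
move=> h; have v0 := block_volume_gt0 k.
rewrite /wave_block /amplitude mulrAC ler_pdivlMr//.
rewrite -mulrA ler_wpM2l ?exprn_ge0//.
have fin := integrable_fin_num (measurable_block k) (wave_integrable psi k).
rewrite -lee_fin fineK// EFinM -leb_block.
rewrite -integral_cst; last exact: measurable_block.
apply: ge0_le_integral => //.
- exact: measurable_block.
- by move=> xi _; rewrite lee_fin invr_ge0.
- exact: (measurable_int _ (wave_integrable psi k)).
Qed.

(** Allows the limits of the real and imaginary parts, obtained separately, to be recombined in the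
    resonant direction. *)
Lemma wave_block_rotate psi k :
  wave_block psi k = cos psi * wave_block 0 k + sin psi * wave_block (pi / 2) k.
Proof.
rewrite /wave_block mulrCA [sin psi * _]mulrCA -mulrDr; congr (_ * _).
have mB := measurable_block k.
have fin psi' := integrable_fin_num mB (wave_integrable psi' k).
rewrite -[RHS]/(fine (EFin _)) EFinD !EFinM !fineK//.
rewrite -!(integralZl mB)//.
rewrite -(integralD mB); [|exact: (integrableZl mB _ (wave_integrable _ k))..].
congr fine; apply: eq_integral => xi _; rewrite -!EFinM -EFinD; congr EFin.
by rewrite !cosB cos0 sin0 cos_pihalf sin_pihalf; ring.
Qed.

End evolution.

Lemma partial_reE t x N : partial_re datum_hat (fun=> 0) t x N = wave_cut t x 0 N.
Proof.
congr fine; apply: (@eq_integral _ _ _ mu) => xi _.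
by rewrite subr0 mul0r subr0.
Qed.

Lemma partial_imE t x N : partial_im datum_hat (fun=> 0) t x N = wave_cut t x (pi / 2) N.
Proof.
congr fine; apply: (@eq_integral _ _ _ mu) => xi _.
by rewrite mul0r addr0 cosB cos_pihalf sin_pihalf mulr0 add0r mulr1.
Qed.

Lemma rotation_le_norm (psi u v : R) : cos psi * u + sin psi * v <= Num.sqrt (u ^+ 2 + v ^+ 2).
Proof.
apply: (le_trans (ler_norm _)); rewrite -sqrtr_sqr ler_wsqrtr//.
have := cos2Dsin2 psi; move: (cos psi) (sin psi) => C S CS.
rewrite -[leRHS]mul1r -CS.
rewrite (_ : (_ + _) * _ = (C * u + S * v) ^+ 2 + (C * v - S * u) ^+ 2); last by ring.
by rewrite lerDl sqr_ge0.
Qed.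

Lemma sum_8 (K : nat) : \sum_(0 <= k < K) 8 ^+ k <= 8 ^+ K / 7 :> R.
Proof.
elim: K => [|K IH]; first by rewrite big_geq// divr_ge0// exprn_ge0.
by rewrite big_nat_recr//= exprS; move: (8 ^+ K) IH => q; lra.
Qed.

(** In the resonant direction block K contributes at least 8^K / 2 and the earlier ones at least
    -8^K / 7; the later blocks change the real and the imaginary part by at most 1 each. Note that
    1/2 - 1/7 > 1/4. *)
Lemma solution_at_resonance x K : fractal a j T x ->
  exists t v, [/\ 0 < t, t <= 3 / T K.+1, schr_at datum_hat (fun=> 0) t x v
    & 8 ^+ K / 4 - 4 <= v].
Proof.
move=> xF; have xT := fractal_near_lattice expo T_start T_scale K xF.
have [t [psi [tT tT' res]]] := resonance expo (T_ge1 K.+1) xT.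
have x2 : tnth x ord0 <= 2 by have [/andP[]] := xT ord0.
have t0 : 0 < t by apply: lt_le_trans tT; rewrite invr_gt0 mulr_gt0.
have lim psi' := eventually_sum_cvg (wave_cut_sum t x psi') (wave_term_near t x psi')
  (fun k N Kk => @wave_term_small t x psi' k K N Kk x2 tT).
have [lre [cre hre]] := lim 0; have [lim_ [cim him]] := lim (pi / 2).
exists t, (Num.sqrt (lre ^+ 2 + lim_ ^+ 2)); split => //.
  exists lre, lim_; split; last split => //.
    by rewrite (_ : partial_re _ _ _ _ = wave_cut t x 0)//; apply/funext => N; exact: partial_reE.
  by rewrite (_ : partial_im _ _ _ _ = wave_cut t x (pi / 2))//; apply/funext => N; exact: partial_imE.
apply: le_trans (rotation_le_norm psi _ _).
set S0 := \sum_(_ <= _ < _) _ in hre; set S1 := \sum_(_ <= _ < _) _ in him.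
have SE : cos psi * S0 + sin psi * S1 = \sum_(0 <= k < K.+1) wave_block t x psi k.
  rewrite !mulr_sumr -big_split/=; apply: eq_bigr => k _.
  by rewrite [RHS]wave_block_rotate.
have hK := wave_block_ge res.
have hS : `|\sum_(0 <= k < K) wave_block t x psi k| <= 8 ^+ K / 7.
  apply: le_trans (sum_8 K); apply: (le_trans (ler_norm_sum _ _ _)).
  by apply: ler_sum => k _; exact: wave_block_le.
rewrite big_nat_recr//= in SE.
have small : 2 * 2^-1 ^+ K.+1 <= 1 :> R.
  by rewrite exprS mulrA divff// mul1r exprn_ile1// invr_le1// ?ler1n// unitfE.
have step (C u S : R) : -1 <= C <= 1 -> `|u - S| <= 1 -> C * S - 1 <= C * u.
  by move=> /andP[C1 C2]; rewrite ler_norml => /andP[h1 h2]; nra.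
have cstep := step _ _ _ (introT andP (conj (cos_geN1 psi) (cos_le1 psi))) (le_trans hre small).
have sstep := step _ _ _ (introT andP (conj (sin_geN1 psi) (sin_le1 psi))) (le_trans him small).
have q0 : 0 <= 8 ^+ K :> R by rewrite exprn_ge0.
move: hS; rewrite ler_norml => /andP[hS _].
lra.
Qed.

Lemma solution_unbounded x : fractal a j T x -> schr_limsup_infty datum_hat (fun=> 0) x.
Proof.
move=> xF M delta d0.
(* The first entry forces 3 / T K.+1 < delta, the second 8^K / 4 - 4 > M. *)
pose K := maxn (Num.truncn (3 / delta)).+1 (Num.truncn (4 * (`|M| + 4))).+1.
have [t [v [t0 tT hv vK]]] := solution_at_resonance K xF.
exists t, v; rewrite t0; split=> /=; last split=> //.
  apply: (le_lt_trans tT); rewrite ltr_pdivrMr// mulrC -ltr_pdivrMr//.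
  apply: (lt_le_trans (truncnS_gt _)); apply: le_trans (scale_ge_nat T_scale _).
  by rewrite ler_nat leqW// leq_maxl.
apply: lt_le_trans vK.
have h : 4 * (`|M| + 4) < 8 ^+ K.
  apply: (lt_le_trans (truncnS_gt _)).
  rewrite -natrX ler_nat (leq_trans (leq_maxr _ _) (ltnW (ltn_expl K _)))//.
have := ler_norm M; lra.
Qed.

End initial_datum.

(* fhat = gre + i gim is the Fourier transform of f; f in H^{s'} iff
   in_Hs_hat s' gre gim. *)
Theorem theorem1p1 (R : realType) (n : nat) (alpha s' : R) :
  (2 <= n)%N ->
  n%:R / 2 < alpha -> alpha <= n%:R ->
  s' < n%:R / (2 * (n%:R + 1)) + (n%:R - 1) / (2 * (n%:R + 1)) * (n%:R - alpha) ->
  exists gre gim : n.-tuple R -> R,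
    in_Hs_hat s' gre gim /\
    exists E : set (n.-tuple R),
      (alpha%:E <= hausdorff_dim E)%E /\
      forall x, E x -> schr_limsup_infty gre gim x.
Proof.
case: n => [|[|n]]// _ alpha_gt alpha_le s'_lt.
have n2 : 2 <= n.+2%:R :> R by rewrite ler_nat.
have alpha_ge1 : 1 <= alpha by lra.
have [a [j [e [b [expo expoE]]]]] := exists_scale_exponents alpha_gt alpha_le.
(* The Sobolev weight is bounded on a block by a power of its largest frequency, which requires a
   nonnegative exponent. The critical regularity is positive, so the maximum stays below it. *)
pose s := Num.max s' 0.
have s0 : 0 <= s by rewrite le_max lexx orbT.
have s_lt : 2 * s < 2^-1 + n.+1%:R * (1 - a).
  rewrite expoE ltr_pM2l// gt_max s'_lt /=; apply: ltr_pwDl.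
    by rewrite divr_gt0// mulr_gt0//; lra.
  by apply: mulr_ge0; [apply: divr_ge0|]; lra.
have [T [T0 TS]] := exists_scale_sequence expo s_lt.
exists (datum_hat a j T), (fun=> 0); split.
  by apply: (datum_in_Hs expo s0 TS); rewrite le_max lexx.
exists (fractal a j T); split; first exact: (fractal_dim expo alpha_ge1 alpha_le T0 TS).
by move=> x xF; exact: (solution_unbounded expo T0 TS).
Qed.
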